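(* There exists a one-to-one correspondence between the set of hypersurfaces $V^{n-1}$ of the conformal space $C^n$ and the set of lightlike hypersurfaces $U^n$ of maximal rank $r=n-1$ of the de Sitter space $S^{n+1}_1$: to $U^n$ there corresponds the hypersurface $V^{n-1}\subset Q^n\sim C^n$ described by the points of tangency $A_0$ of the tangent hyperplanes of $U^n$ with $Q^n$. Under this correspondence, to the (parabolic) pencils of tangent hyperspheres of the hypersurface $V^{n-1}$ there correspond the isotropic rectilinear generators of the lightlike hypersurface $U^n$.
   Context: Let $(\cdot,\cdot)$ be a quadratic form of signature $(n+1,1)$ on $\mathbb{R}^{n+2}$, let $P^{n+1}$ be the associated real projective space, and let $Q^n=\{(x,x)=0\}\subset P^{n+1}$ be the corresponding oval hyperquadric (the absolute). The de Sitter space $S^{n+1}_1$ is identified with the exterior domain $\{(x,x)>0\}$ of $Q^n$ in $P^{n+1}$; with points normalized by $(x,x)=1$, its pseudo-Riemannian metric is $(dx,dx)$, of Lorentzian signature $(n,1)$. The conformal space $C^n$ is identified with $Q^n$ (the Darboux mapping). Hyperspheres of $C^n$ are the sections of $Q^n$ by hyperplanes $\xi$ of $P^{n+1}$; assigning to a hyperplane $\xi$ its pole $x$ with respect to $Q^n$ identifies (real, non-point) hyperspheres of $C^n$ with points of $S^{n+1}_1$; points of $Q^n$ itself are hyperspheres of zero radius. A straight line of $P^{n+1}$ tangent to $Q^n$ at a point $y$ corresponds to a parabolic pencil of hyperspheres, i.e. hyperspheres tangent to one another at $y$. The pencil of tangent hyperspheres of a hypersurface $V^{n-1}\subset C^n$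 at $y$ is the parabolic pencil of all hyperspheres tangent to $V^{n-1}$ at $y$. A hypersurface $U^n$ ($\dim U^n=n$) of $S^{n+1}_1$ is called lightlike if each of its tangent hyperplanes $\eta=T_x(U^n)$ is tangent to $Q^n$; write $A_n=x$ and $A_0$ for the point of tangency of $\eta$ with $Q^n$. The straight lines $A_nA_0$ are the isotropic rectilinear generators of $U^n$; the tangent hyperplane is constant along each of them. It is assumed that the entire projective straight line $A_nA_0$ belongs to $U^n$, and $U^n$ is regarded as the image of a mapping $f:M^{n-1}\times l\to P^{n+1}$ ($l$ a projective line) sending $l$ to the lines $A_nA_0$; singular points are allowed on these lines. The rank $r$ of $U^n$ is the number of parameters on which the family of its tangent hyperplanes depends; one has $r\le n-1$. All functions are real and differentiable; manifolds are smooth with the possible exception of isolated singular points and singular submanifolds. *)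

(* Defs.v *)
From HB Require Import structures.
From mathcomp Require Import all_boot all_order all_algebra.
From mathcomp Require Import all_classical all_reals all_analysis.

Set Implicit Arguments.
Unset Strict Implicit.
Unset Printing Implicit Defensive.

Import Order.TTheory GRing.Theory Num.Theory.
Import numFieldNormedType.Exports.

Local Open Scope classical_set_scope.
Local Open Scope ring_scope.

(* Only meaningful for open [D]: ['D_v f x] is the derivative of [f] at [x] in
   the direction [v], so [Ck k D f] says that [f] is of class C^k on [D]. *)
Fixpoint Ck (R : realType) (V W : normedModType R) (k : nat) (D : set V)
    (f : V -> W) : Prop :=
  if k is k'.+1 then
    (forall x, D x -> differentiable f x) /\
    (forall v, Ck k' D (fun x => 'D_v f x))
  else forall x, D x -> {for x, continuous f}.

Definition smooth_on (R : realType) (V W : normedModType R) (D : set V)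
    (f : V -> W) : Prop := forall k, Ck k D f.

(* A chart is given by its inverse, a local parametrization [par] of [M] whose
   values outside [dom] are irrelevant. *)
Record chart (R : realType) (m : nat) (M : topologicalType) := Chart {
  dom : set 'rV[R]_m;
  par : 'rV[R]_m -> M }.

Definition chart_homeo (R : realType) (m : nat) (M : topologicalType)
    (c : chart R m M) : Prop :=
  [/\ open (dom c),
      {in dom c &, injective (par c)} &
      forall W, W `<=` dom c -> open W <-> open (par c @` W)].

(* [h] is smooth when expressed in the charts [c] and [c']. *)
Definition smooth_in_charts (R : realType) (m : nat) (M M' : topologicalType)
    (h : M -> M') (c : chart R m M) (c' : chart R m M') : Prop :=
  forall a b, dom c a -> dom c' b -> h (par c a) = par c' b ->
  exists (W : set 'rV[R]_m) (g : 'rV[R]_m -> 'rV[R]_m),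
    [/\ open W, W a, W `<=` dom c, smooth_on W g &
        forall x, W x -> dom c' (g x) /\ h (par c x) = par c' (g x)].

Record manifold (R : realType) (m : nat) := Manifold {
  points :> topologicalType;
  atlas : set (chart R m points);
  _ : hausdorff_space points;
  _ : @second_countable points;
  _ : forall c, atlas c -> chart_homeo c;
  _ : forall u, exists c a, [/\ atlas c, dom c a & par c a = u];
  _ : forall c c', atlas c -> atlas c' -> smooth_in_charts id c c' }.

Definition smooth_map (R : realType) (m : nat) (M M' : manifold R m)
    (h : M -> M') : Prop :=
  forall c c', atlas c -> atlas c' -> smooth_in_charts h c c'.

Definition diffeomorphism (R : realType) (m : nat) (M M' : manifold R m)
    (h : M -> M') : Prop :=
  exists h' : M' -> M,
    [/\ cancel h h', cancel h' h, smooth_map h & smooth_map h'].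

(* A projective subspace of dimension [d] of the projective space P(R^N) is a
   vector subspace of dimension [d.+1]; in particular a point is a vector line
   and, when [N = n.+2], a hyperplane is a subspace of dimension [n.+1]. *)
Notation psubspace R N := {vspace 'rV[R]_N}.

Definition bform (R : realType) (N : nat) (G : 'M[R]_N) (x y : 'rV[R]_N) : R :=
  (x *m G *m y^T) 0 0.

(* Signature (n+1, 1); this forces [G] to be symmetric. *)
Definition lorentzian (R : realType) (n : nat) (G : 'M[R]_n.+2) : Prop :=
  exists2 P : 'M[R]_n.+2, P \in unitmx &
    P *m G *m P^T = diag_mx (\row_i (if i == ord_max then -1 else 1)).

(* The polar subspace, i.e. the orthogonal of [A] (see [polarP]). *)
Definition polar (R : realType) (N : nat) (G : 'M[R]_N) (A : psubspace R N) :
    psubspace R N :=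
  (\bigcap_(v <- vbasis A)
     lker (linfun (mulmxr (G *m v^T) : 'rV[R]_N -> 'rV[R]_1)))%VS.

Lemma polarP (R : realType) (N : nat) (G : 'M[R]_N) (A : psubspace R N)
    (x : 'rV[R]_N) :
  x \in polar G A <-> (forall a, a \in A -> bform G x a = 0).
Proof.
have kerE v : (x \in lker (linfun (mulmxr (G *m v^T) : 'rV[R]_N -> 'rV[R]_1)))
    = (bform G x v == 0).
  rewrite memv_ker lfunE /= mulmxA /bform; apply/eqP/eqP => [->|h].
    by rewrite mxE.
  by apply/rowP => i; rewrite (ord1 i) h mxE.
have polE : (x \in polar G A) = all (fun v => bform G x v == 0) (vbasis A).
  rewrite /polar; elim: (tval (vbasis A)) => [|v s IH] /=.
    by rewrite big_nil memvf.
  by rewrite big_cons memv_cap kerE IH.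
rewrite polE; split => [/allP h a /coord_vbasis ->|h]; last first.
  by apply/allP => v /vbasis_mem /h ->.
rewrite /bform linear_sum mulmx_sumr summxE big1 // => i _.
rewrite linearZ -scalemxAr mxE.
have /h /eqP : (vbasis A)`_i \in vbasis A by rewrite mem_nth ?size_tuple.
by rewrite /bform => ->; rewrite mulr0.
Qed.

Definition absolute (R : realType) (N : nat) (G : 'M[R]_N) (x : psubspace R N) :
    Prop :=
  \dim x = 1%N /\ forall v, v \in x -> bform G v v = 0.

(* The points of the de Sitter space, the exterior domain of the absolute. *)
Definition deSitter (R : realType) (N : nat) (G : 'M[R]_N) (x : psubspace R N) :
    Prop :=
  \dim x = 1%N /\ forall v, v \in x -> v != 0 -> 0 < bform G v v.

(* The tangent hyperplane of the absolute at one of its points is the polar of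
   that point. *)
Definition tangent_to_absolute (R : realType) (N : nat) (G : 'M[R]_N)
    (eta z : psubspace R N) : Prop :=
  absolute G z /\ eta = polar G z.

Definition points_of (R : realType) (N : nat) (A : psubspace R N) :
    set (psubspace R N) :=
  [set x | \dim x = 1%N /\ (x <= A)%VS].

Definition row_span (R : realType) (k N : nat) (B : 'M[R]_(k, N)) :
    psubspace R N :=
  (\sum_(i < k) <[row i B]>)%VS.

(* A smooth frame, on [W], of the family [F] read in the chart [c]. *)
Definition local_frame (R : realType) (m N k : nat) (M : manifold R m)
    (F : M -> psubspace R N) (c : chart R m M) (W : set 'rV[R]_m)
    (B : 'rV[R]_m -> 'M[R]_(k, N)) : Prop :=
  [/\ atlas c, open W, W `<=` dom c, smooth_on W B &
      forall b, W b -> row_free (B b) /\ F (par c b) = row_span (B b)].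

Definition smooth_family (R : realType) (m N k : nat) (M : manifold R m)
    (F : M -> psubspace R N) : Prop :=
  forall c a, atlas c -> dom c a ->
  exists (W : set 'rV[R]_m) (B : 'rV[R]_m -> 'M[R]_(k, N)),
    W a /\ local_frame F c W B.

(* A smooth family of projective lines (k = 2) is locally the map
     (a, [s]) |-> [s *m B a],   a in W, s in R^k nonzero,
   of M x l into the projective space; it is just a map from M for k = 1.
   [T] is the projective subspace tangent to that map at the point [x] of the
   subspace [F u]: the image of the differential at (a, s) of the homogeneous
   map (a, s) |-> s *m B a.  The point is regular iff \dim T = m + k. *)
Definition tangent_space (R : realType) (m N k : nat) (M : manifold R m)
    (F : M -> psubspace R N) (u : M) (x T : psubspace R N) : Prop :=
  exists (c : chart R m M) (W : set 'rV[R]_m)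
         (B : 'rV[R]_m -> 'M[R]_(k, N)) (a : 'rV[R]_m) (s : 'rV[R]_k),
    [/\ local_frame F c W B, W a /\ par c a = u,
        s != 0 /\ x = <[s *m B a]>%VS &
        T = (row_span (B a) +
             \sum_(i < m) <[(s *m 'D_(delta_mx 0 i) B a)%R]>)%VS].

Definition rank_at (R : realType) (m N : nat) (M : manifold R m)
    (y : M -> psubspace R N) (u : M) (r : nat) : Prop :=
  exists T, tangent_space 1 y u (y u) T /\ \dim T = r.+1.

(* A manifold of dimension n-1 together with a family of subspaces of the
   (n+1)-dimensional projective space: points for hypersurfaces of C^n,
   rectilinear generators for lightlike hypersurfaces. *)
Record subspace_family (R : realType) (n : nat) := SubspaceFamily {
  base : manifold R n.-1;
  member :> base -> psubspace R n.+2 }.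

(* A hypersurface does not depend on its parametrization. *)
Definition same_family (R : realType) (n : nat) (F F' : subspace_family R n) : Prop :=
  exists h : base F -> base F',
    diffeomorphism h /\ forall u, F' (h u) = F u.

(* [set] lives in too low a universe for [subspace_family R n]. *)
Definition family_class (R : realType) (n : nat) (F : subspace_family R n) :
    subspace_family R n -> Prop := fun F' => same_family F F'.

(* The analogue of [set_bij], for the same reason. *)
Definition one_to_one (T T' : Type) (A : T -> Prop) (B : T' -> Prop)
    (f : T -> T') : Prop :=
  [/\ forall x, A x -> B (f x),
      forall x x', A x -> A x' -> f x = f x' -> x = x' &
      forall y, B y -> exists2 x, A x & f x = y].

Definition conformal_hypersurface (R : realType) (n : nat) (G : 'M[R]_n.+2)
    (V : subspace_family R n) : Prop :=
  [/\ smooth_family 1 V,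
      forall u, absolute G (V u) &
      forall u, rank_at V u n.-1].

Definition conformal_hypersurfaces (R : realType) (n : nat) (G : 'M[R]_n.+2)
    (C : subspace_family R n -> Prop) : Prop :=
  exists2 V, conformal_hypersurface G V & C = family_class V.

(* The hypersphere with pole [x], a set of points of the absolute. *)
Definition hypersphere (R : realType) (N : nat) (G : 'M[R]_N)
    (x : psubspace R N) : set (psubspace R N) :=
  [set z | absolute G z /\ (z <= polar G x)%VS].

(* At its point [z], the hypersphere with pole [x], a section of the absolute by
   the hyperplane [polar G x], has the tangent space [polar G x :&: polar G z]. *)
Definition tangent_hypersphere (R : realType) (n : nat) (G : 'M[R]_n.+2)
    (V : subspace_family R n) (u : base V) (x : psubspace R n.+2) : Prop :=
  [/\ deSitter G x, hypersphere G x (V u) &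
      tangent_space 1 V u (V u) (polar G x :&: polar G (V u))%VS].

Arguments tangent_hypersphere {R n} G V u x.

(* The poles of the hyperspheres of the pencil; the point of contact itself is
   the hypersphere of zero radius of this parabolic pencil. *)
Definition tangent_pencil (R : realType) (n : nat) (G : 'M[R]_n.+2)
    (V : subspace_family R n) (u : base V) : set (psubspace R n.+2) :=
  [set x | x = V u \/ tangent_hypersphere G V u x].

Arguments tangent_pencil {R n} G V u.

(* [eta] is the tangent hyperplane of [U] at a regular point [x], lying in the
   de Sitter space, of the generator [U u]. *)
Definition tangent_hyperplane (R : realType) (n : nat) (G : 'M[R]_n.+2)
    (U : subspace_family R n) (u : base U) (x eta : psubspace R n.+2) : Prop :=
  [/\ deSitter G x, tangent_space 2 U u x eta & \dim eta = n.+1].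

Arguments tangent_hyperplane {R n} G U u x eta.

(* Singular points are allowed on every generator, but not only such points. *)
Definition lightlike_hypersurface (R : realType) (n : nat) (G : 'M[R]_n.+2)
    (U : subspace_family R n) : Prop :=
  [/\ smooth_family 2 U,
      forall u, exists x eta, tangent_hyperplane G U u x eta &
      forall (u : base U) x eta, tangent_hyperplane G U u x eta ->
        exists A0, tangent_to_absolute G eta A0 /\ U u = (x + A0)%VS].

(* The family of tangent hyperplanes, constant along each generator, is read as
   the map sending [u] to the point [polar 1%:M (eta u)] of the dual projective
   space, i.e. to the coefficients of the equation of [eta u]. *)
Definition lightlike_rank (R : realType) (n : nat) (G : 'M[R]_n.+2)
    (U : subspace_family R n) (r : nat) : Prop :=
  exists eta : base U -> psubspace R n.+2,
    (forall u eta', (exists x, tangent_hyperplane G U u x eta') <->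
                    eta' = eta u) /\
    forall u, rank_at (fun u' => polar 1%:M (eta u')) u r.

Definition lightlike_maximal (R : realType) (n : nat) (G : 'M[R]_n.+2)
    (U : subspace_family R n) : Prop :=
  lightlike_hypersurface G U /\ lightlike_rank G U n.-1.

Definition lightlike_hypersurfaces_maximal (R : realType) (n : nat)
    (G : 'M[R]_n.+2) (C : subspace_family R n -> Prop) : Prop :=
  exists2 U, lightlike_maximal G U & C = family_class U.

(* [y u] is the point of tangency, with the absolute, of the tangent hyperplanes
   of [U] along the generator [U u]. *)
Definition tangency_points (R : realType) (n : nat) (G : 'M[R]_n.+2)
    (U : subspace_family R n) (y : base U -> psubspace R n.+2) : Prop :=
  forall (u : base U) x eta, tangent_hyperplane G U u x eta ->
    tangent_to_absolute G eta (y u).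

Arguments tangency_points {R n} G U y.

(* Main.v *)
(** Write [T u] for the space spanned by the point [V u] of a hypersurface of the
    absolute and by the derivatives of [V] at [u].  Differentiating
    [(U, V) = 0], one sees that the tangent hyperplane of a family of lines [U],
    [U u] lying in the polar of [V u], is polar to [V u] at the point [x] of [U u]
    exactly when [x] is orthogonal to [T u].  So the lightlike hypersurfaces of
    maximal rank are the families [U u = polar (T u)], and [V u] is recovered as
    the pole of the tangent hyperplane.  The hyperspheres tangent to [V] at [u]
    are the points [x] such that [T u] is the intersection of the polars of [x]
    and of [V u], that is, such that [polar (T u)] is the line joining [x] to
    [V u].  Regular points exist on [U u] because the pairing of the derivatives
    of [U] with those of [V] is affine along the line, with the Gram matrix of
    the derivatives of [V], positive definite modulo [V u], as leading
    coefficient. *)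
Require Import Defs.
From mathcomp Require Import all_boot all_order all_algebra perm.
From mathcomp Require Import all_classical all_reals all_analysis.
From mathcomp Require Import ring.

Set Implicit Arguments.
Unset Strict Implicit.
Unset Printing Implicit Defensive.

Import Order.TTheory GRing.Theory Num.Theory.
Import numFieldNormedType.Exports.

Local Open Scope classical_set_scope.
Local Open Scope ring_scope.

(** * Calculus of maps of class C^k *)

Section Ck_calculus.
Context {R : realType} {V : normedModType R}.
Implicit Types (D : set V) (k : nat).

(** Only values near [x] enter the little-o expansion, so that of [f] serves for [g]; [diff_unique]
    then identifies the differential. *)
Lemma near_eq_diff (W : normedModType R) (f g : V -> W) x :
  (\near x, f x = g x) -> differentiable f x -> differentiable g x.
Proof.
move=> fg df; have fgx : f x = g x := nbhs_singleton fg.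
have [dfc /eqaddoP fo] := (diff_locallyP x f).1 df.
have go : g \o shift x = cst (g x) + 'd f x +o_ 0 id.
  apply/eqaddoP => e e0; move: fg; rewrite (near_shift 0) subr0 => fg.
  by apply: filterS2 fg (fo e e0) => y /=; rewrite !fctE /= fgx => ->.
by apply/diff_locallyP; rewrite (diff_unique dfc go).
Qed.

(** On an open [D], agreement on [D] is agreement near each point, so it passes to derivatives. The
    differentiation rules hold only on [D] and enter the inductions below through this lemma. *)
Lemma Ck_eq (W : normedModType R) k D (f g : V -> W) :
  open D -> {in D, f =1 g} -> Ck k D f -> Ck k D g.
Proof.
move=> oD; elim: k f g => [|k IH] f g fg /=.
  move=> cf x Dx; rewrite /prop_for /continuous_at -fg ?inE//.
  apply: cvg_trans (cf x Dx); apply: near_eq_cvg.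
  by near=> y; rewrite fg ?inE//; near: y; exact: open_nbhs_nbhs.
have fgn x : D x -> \near x, f x = g x.
  move=> Dx; near=> y; rewrite fg ?inE//; near: y; exact: open_nbhs_nbhs.
move=> [df Cf]; split=> [x Dx|v]; first exact: near_eq_diff (fgn x Dx) (df x Dx).
apply: IH (Cf v) => x /set_mem Dx; exact/near_eq_derive/fgn.
Unshelve. all: by end_near. Qed.

Lemma Ck_sub (W : normedModType R) k D D' (f : V -> W) :
  D' `<=` D -> Ck k D f -> Ck k D' f.
Proof.
move=> sD; elim: k f => [|k IH] f /=; first by move=> cf x /sD/cf.
by move=> [df Cf]; split=> [x /sD/df//|v]; exact: IH.
Qed.

Lemma CkW (W : normedModType R) k D (f : V -> W) : Ck k.+1 D f -> Ck k D f.
Proof.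
elim: k f => [|k IH] f [df Cf]; first by move=> x /df/differentiable_continuous.
by split=> // v; exact: IH.
Qed.

Lemma Ck_cst (W : normedModType R) k D (a : W) : Ck k D (cst a).
Proof.
elim: k a => [|k IH] a /=; first by move=> x _; exact: cvg_cst.
split=> [x _|v]; first exact: differentiable_cst.
rewrite (_ : (fun x => _) = cst 0)//; apply/funext => x; exact: derive_cst.
Qed.

Lemma Ck_add (W : normedModType R) k D (f g : V -> W) :
  open D -> Ck k D f -> Ck k D g -> Ck k D (f + g).
Proof.
move=> oD; elim: k f g => [|k IH] f g /=.
  by move=> cf cg x Dx; exact: (continuousD (cf x Dx) (cg x Dx)).
move=> [df Cf] [dg Cg]; split=> [x Dx|v].
  by exact: (differentiableD (df x Dx) (dg x Dx)).
apply: Ck_eq (IH _ _ (Cf v) (Cg v)) => // x /set_mem Dx.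
by rewrite (deriveD (diff_derivable (df x Dx)) (diff_derivable (dg x Dx))).
Qed.

Lemma Ck_mul k D (f g : V -> R) :
  open D -> Ck k D f -> Ck k D g -> Ck k D (f * g).
Proof.
move=> oD; elim: k f g => [|k IH] f g.
  by move=> cf cg x Dx; exact: (continuousM (cf x Dx) (cg x Dx)).
move=> Cf' Cg'; have [[df Cf] [dg Cg]] := (Cf', Cg'); split=> [x Dx|v].
  by exact: (differentiableM (df x Dx) (dg x Dx)).
apply: (@Ck_eq _ _ _ (f * 'D_v g + g * 'D_v f)) => // [x /set_mem Dx|].
  by rewrite (deriveM (diff_derivable (df x Dx)) (diff_derivable (dg x Dx))).
exact: (Ck_add oD (IH _ _ (CkW Cf') (Cg v)) (IH _ _ (CkW Cg') (Cf v))).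
Qed.

Lemma Ck_inv k D (f : V -> R) :
  open D -> (forall x, D x -> f x != 0) -> Ck k D f ->
  Ck k D (fun x => (f x)^-1).
Proof.
move=> oD f0; elim: k => [|k IH] /=.
  by move=> cf x Dx; exact: (continuousV (f0 x Dx) (cf x Dx)).
move=> Cf'; have [df Cf] := Cf'; split=> [x Dx|v].
  by exact: (differentiableV (df x Dx) (f0 x Dx)).
have Ci := IH (CkW Cf').
(* The derivative is written with two factors [(f x)^-1], so that the induction hypothesis on the
   inverse applies to it. *)
apply: (@Ck_eq _ _ _ (cst (-1) * ((fun x => (f x)^-1) * (fun x => (f x)^-1) * 'D_v f)))
    => // [x /set_mem Dx|].
  rewrite deriveV; [|exact: f0|exact/diff_derivable/df].
  by rewrite !fctE mulN1r expr2 invfM scaleNr.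
by do !apply: Ck_mul => //; exact: Ck_cst.
Qed.

Lemma Ck_sum k D (I : Type) (r : seq I) (P : pred I) (F : I -> V -> R) :
  open D -> (forall i, Ck k D (F i)) ->
  Ck k D (fun x => \sum_(i <- r | P i) F i x).
Proof.
move=> oD CF; elim: r => [|i r IH].
  by apply: Ck_eq (Ck_cst k D (0 : R)) => // x _; rewrite big_nil.
case Pi : (P i); last by apply: Ck_eq IH => // x _; rewrite big_cons Pi.
by apply: Ck_eq (Ck_add oD (CF i) IH) => // x _; rewrite big_cons Pi.
Qed.

Lemma Ck_prod k D (I : Type) (r : seq I) (P : pred I) (F : I -> V -> R) :
  open D -> (forall i, Ck k D (F i)) ->
  Ck k D (fun x => \prod_(i <- r | P i) F i x).
Proof.
move=> oD CF; elim: r => [|i r IH].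
  by apply: Ck_eq (Ck_cst k D (1 : R)) => // x _; rewrite big_nil.
case Pi : (P i); last by apply: Ck_eq IH => // x _; rewrite big_cons Pi.
by apply: Ck_eq (Ck_mul oD (CF i) IH) => // x _; rewrite big_cons Pi.
Qed.

Lemma continuous_mxP p q (f : V -> 'M[R]_(p, q)) x :
  {for x, continuous f} <-> forall i j, {for x, continuous (fun y => f y i j)}.
Proof.
split=> [cf i j|cf].
  exact: (@continuous_comp _ _ _ f (fun M => M i j) x cf (@coord_continuous _ _ _ i j _)).
apply/cvgrPdist_le => e e0; near=> y.
rewrite /Num.Def.normr/= mx_normrE (bigmax_le _ (ltW e0))//= => i _.
rewrite !mxE/=; move: i; near: y; apply: filter_forall => /= i.
exact: (cvgrPdist_le _ _).1 (cf i.1 i.2) e e0.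
Unshelve. all: by end_near. Qed.

Lemma differentiable_mxP p q (f : V -> 'M[R]_(p, q)) x :
  differentiable f x <-> forall i j, differentiable (fun y => f y i j) x.
Proof.
split=> [df i j|df].
  exact: (@differentiable_comp _ _ _ _ f (fun M => M i j) x df
    (differentiable_coord _ _ _)).
have -> : f = \sum_(i < p) \sum_(j < q) (fun y => f y i j *: delta_mx i j).
  apply/funext => y; rewrite [LHS]matrix_sum_delta fct_sumE; apply: eq_bigr => i _.
  by rewrite fct_sumE.
apply: differentiable_sum => i; apply: differentiable_sum => j.
exact: differentiableZl (df i j).
Qed.

Lemma derive_coord p q (f : V -> 'M[R]_(p, q)) x v i j :
  differentiable f x -> 'D_v (fun y => f y i j) x = 'D_v f x i j.
Proof. by move=> df; rewrite derive_mx ?mxE//; exact: diff_derivable. Qed.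

Lemma Ck_mxP k D p q (f : V -> 'M[R]_(p, q)) : open D ->
  Ck k D f <-> forall i j, Ck k D (fun x => f x i j).
Proof.
move=> oD; elim: k f => [|k IH] f /=.
  split=> [cf i j x /cf/continuous_mxP/(_ i j)//|cf x Dx].
  by apply/continuous_mxP => i j; exact: cf.
split=> [[df Cf] i j|Cf].
  split=> [x /df/differentiable_mxP//|v].
  apply: (Ck_eq oD) ((IH ('D_v f)).1 (Cf v) i j) => x /set_mem Dx.
  by rewrite derive_coord//; exact: df.
have df x : D x -> differentiable f x.
  by move=> Dx; apply/differentiable_mxP => i j; have [/(_ x Dx)] := Cf i j.
split=> // v; apply/IH => i j; apply: (Ck_eq oD) ((Cf i j).2 v) => x /set_mem Dx.
by rewrite derive_coord//; exact: df.
Qed.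

End Ck_calculus.

Section Ck_comp.
Context {R : realType} {V : normedModType R}.

Lemma derive_comp_row (W : normedModType R) m (f : 'rV[R]_m -> W)
    (g : V -> 'rV[R]_m) x v :
  differentiable g x -> differentiable f (g x) ->
  'D_v (f \o g) x = \sum_(i < m) 'D_v g x 0 i *: 'D_(delta_mx 0 i) f (g x).
Proof.
move=> dg df; rewrite deriveE; last exact: differentiable_comp.
rewrite diff_comp //= -(deriveE v dg) [X in 'd f _ X]row_sum_delta linear_sum.
by apply: eq_bigr => i _; rewrite linearZ (deriveE _ df).
Qed.

(** The chain rule gives a sum of products of a coordinate of ['D_v g] with a partial derivative of
    [f] composed with [g]; the induction is on [k] for all [f], so it covers these partial
    derivatives. *)
Lemma Ck_comp k m (D : set V) (E : set 'rV[R]_m) (f : 'rV[R]_m -> R) (g : V -> 'rV[R]_m) :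
  open D -> open E -> (forall x, D x -> E (g x)) ->
  Ck k D g -> Ck k E f -> Ck k D (f \o g).
Proof.
move=> oD oE gE; elim: k f => [|k IH] f.
  move=> cg cf x Dx; apply: continuous_comp; first exact: cg.
  exact/cf/gE.
move=> Cg' Cf'; have [[dg Cg] [df Cf]] := (Cg', Cf'); split=> [x Dx|v].
  exact: (differentiable_comp (dg x Dx) (df _ (gE x Dx))).
pose h i := (fun x => 'D_v g x 0 i) * ('D_(delta_mx 0 i) f \o g).
apply: (@Ck_eq _ _ _ _ _ (fun x => \sum_(i < m) h i x)) => // [x /set_mem Dx|].
  by rewrite (derive_comp_row _ (dg x Dx) (df _ (gE x Dx))).
apply: Ck_sum => // i; apply: Ck_mul => //; last exact: (IH _ (CkW Cg') (Cf _)).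
by have /Ck_mxP := Cg v; apply.
Qed.

End Ck_comp.

Section smooth_matrices.
Context {R : realType} {V : normedModType R}.
Implicit Types (D : set V).

Lemma smooth_onS (W : normedModType R) D D' (f : V -> W) :
  D' `<=` D -> smooth_on D f -> smooth_on D' f.
Proof. by move=> sD sf k; exact: Ck_sub (sf k). Qed.

Lemma smooth_on_eq (W : normedModType R) D (f g : V -> W) :
  open D -> {in D, f =1 g} -> smooth_on D f -> smooth_on D g.
Proof. by move=> oD fg sf k; exact: Ck_eq (sf k). Qed.

Lemma smooth_on_cst (W : normedModType R) D (a : W) : smooth_on D (fun=> a).
Proof. by move=> k; exact: Ck_cst. Qed.

Lemma smooth_on_continuous (W : normedModType R) D (f : V -> W) x :
  smooth_on D f -> D x -> {for x, continuous f}.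
Proof. by move=> /(_ 0%N); apply. Qed.

Lemma smooth_on_differentiable (W : normedModType R) D (f : V -> W) x :
  smooth_on D f -> D x -> differentiable f x.
Proof. by move=> /(_ 1%N)[df _] /df. Qed.

Lemma smooth_on_derive (W : normedModType R) D (f : V -> W) v :
  smooth_on D f -> smooth_on D ('D_v f).
Proof. by move=> sf k; have [_] := sf k.+1; apply. Qed.

Lemma smooth_on_comp m p q D (E : set 'rV[R]_m) (f : 'rV[R]_m -> 'M[R]_(p, q))
    (g : V -> 'rV[R]_m) :
  open D -> open E -> (forall x, D x -> E (g x)) ->
  smooth_on D g -> smooth_on E f -> smooth_on D (f \o g).
Proof.
move=> oD oE gE sg sf k; apply/Ck_mxP => // i j.
exact: (@Ck_comp _ _ k m D E (fun y => f y i j) g oD oE gE (sg k)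
  ((Ck_mxP k f oE).1 (sf k) i j)).
Qed.

Lemma smooth_on_mxP D p q (f : V -> 'M[R]_(p, q)) : open D ->
  smooth_on D f <-> forall i j, smooth_on D (fun x => f x i j).
Proof.
move=> oD; split=> [sf i j k|sf k].
  by have /(Ck_mxP _ _ oD) := sf k; apply.
by apply/Ck_mxP => // i j; exact: sf.
Qed.

Lemma smooth_on_mulmx D p q r (f : V -> 'M[R]_(p, q)) (g : V -> 'M[R]_(q, r)) :
  open D -> smooth_on D f -> smooth_on D g ->
  smooth_on D (fun x => f x *m g x).
Proof.
move=> oD /smooth_on_mxP-/(_ oD) sf /smooth_on_mxP-/(_ oD) sg.
apply/smooth_on_mxP => // i j k.
pose h l := (fun x => f x i l) * (fun x => g x l j).
apply: (@Ck_eq _ _ _ _ _ (fun x => \sum_l h l x)) => //.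
  by move=> x _; rewrite mxE.
by apply: Ck_sum => // l; apply: Ck_mul => //; [exact: sf|exact: sg].
Qed.

Lemma smooth_on_det D p (f : V -> 'M[R]_p) :
  open D -> smooth_on D f -> smooth_on D (fun x => \det (f x)).
Proof.
move=> oD /smooth_on_mxP-/(_ oD) sf k.
pose h (s : 'S_p) := cst ((-1) ^+ s) * (fun x => \prod_i f x i (s i)).
apply: (@Ck_eq _ _ _ _ _ (fun x => \sum_s h s x)) => //.
apply: Ck_sum => // s; apply: Ck_mul => //; first exact: Ck_cst.
by apply: Ck_prod => // i; exact: sf.
Qed.

(** Cramer's rule: each entry of the inverse is a cofactor divided by the determinant. *)
Lemma smooth_on_invmx D p (f : V -> 'M[R]_p) :
  open D -> (forall x, D x -> f x \in unitmx) -> smooth_on D f ->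
  smooth_on D (fun x => invmx (f x)).
Proof.
move=> oD fu sf; have /smooth_on_mxP-/(_ oD) sfij := sf.
apply/smooth_on_mxP => // i j k.
pose m x := row' j (col' i (f x)).
pose h := (fun x => (\det (f x))^-1) *
          (cst ((-1) ^+ (j + i)) * (fun x => \det (m x))).
apply: (@Ck_eq _ _ _ _ _ h) => // [x /set_mem Dx|].
  by rewrite /invmx fu// !mxE.
apply: Ck_mul => //.
  apply: Ck_inv => //; last exact: smooth_on_det.
  by move=> x /fu; rewrite unitmxE unitfE.
apply: Ck_mul => //; first exact: Ck_cst.
apply: smooth_on_det => //; apply/smooth_on_mxP => // a b.
by rewrite (_ : (fun x => _) = (fun x => f x (lift j a) (lift i b)))//;
   apply/funext => x; rewrite !mxE.
Qed.

Lemma open_setI_preimage (T : topologicalType) D (f : V -> T) (E : set T) :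
  open D -> open E -> (forall x, D x -> {for x, continuous f}) ->
  open (D `&` f @^-1` E).
Proof.
move=> oD oE cf; rewrite openE => x [Dx Efx].
apply: filterI; first exact: open_nbhs_nbhs.
by apply: cf => //; exact: open_nbhs_nbhs.
Qed.

Lemma open_unitmx D p (f : V -> 'M[R]_p) :
  open D -> smooth_on D f -> open (D `&` [set x | f x \in unitmx]).
Proof.
move=> oD sf.
have -> : [set x | f x \in unitmx] = (fun x => \det (f x)) @^-1` [set t | t != 0].
  by apply/seteqP; split=> x /=; rewrite unitmxE unitfE.
apply: (open_setI_preimage oD (@open_neq R 0)).
by move=> x; exact: (smooth_on_continuous (smooth_on_det oD sf)).
Qed.

Lemma derive_mulmx p q r (f : V -> 'M[R]_(p, q)) (g : V -> 'M[R]_(q, r)) x v :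
  differentiable f x -> differentiable g x ->
  'D_v (fun y => f y *m g y) x = 'D_v f x *m g x + f x *m 'D_v g x.
Proof.
move=> df dg; have dfij := (differentiable_mxP _ _).1 df.
have dgij := (differentiable_mxP _ _).1 dg.
have fgE i j : (fun y => (f y *m g y) i j) =
    \sum_l ((fun y => f y i l) * (fun y => g y l j)).
  by apply/funext => y; rewrite mxE fct_sumE.
have dfg : differentiable (fun y => f y *m g y) x.
  apply/differentiable_mxP => i j; rewrite fgE.
  by apply: differentiable_sum => l; exact: differentiableM.
apply/matrixP => i j; rewrite -derive_coord// fgE derive_sum; last first.
  by move=> l; apply/diff_derivable/differentiableM.
rewrite !mxE -big_split/=; apply: eq_bigr => l _.
rewrite deriveM; [|exact: diff_derivable..].
by rewrite !derive_coord// addrC; congr (_ + _); exact: mulrC.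
Qed.

Lemma derive_mulmxr p q r (f : V -> 'M[R]_(p, q)) (A : 'M[R]_(q, r)) x v :
  differentiable f x -> 'D_v (fun y => f y *m A) x = 'D_v f x *m A.
Proof.
move=> df; rewrite derive_mulmx//.
by rewrite [X in _ + _ *m X]derive_cst mulmx0 addr0.
Qed.

End smooth_matrices.

(** * Spans, polars and Lorentzian forms *)

Section row_span.
Context {R : realType} {N : nat}.

(** From here on subspaces are handled as row spaces: inclusion becomes [submx] and dimension
    becomes rank. *)
Lemma memv_row_span k (B : 'M[R]_(k, N)) (v : 'rV[R]_N) :
  (v \in row_span B) = (v <= B)%MS.
Proof.
apply/memv_sumP/idP => [[vs vsB ->]|/submxP[D ->]].
  apply: summx_sub => i _; have /vlineP[c ->] := vsB i isT.
  exact/scalemx_sub/row_sub.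
exists (fun i => D 0 i *: row i B) => [i _|].
  by rewrite memvZ// memv_line.
exact: mulmx_sum_row.
Qed.

Lemma row_spanS k l (A : 'M[R]_(k, N)) (B : 'M[R]_(l, N)) :
  (row_span A <= row_span B)%VS = (A <= B)%MS.
Proof.
apply/subvP/row_subP => [AB i|AB v]; last first.
  by rewrite !memv_row_span => /submx_trans; apply; exact/row_subP.
by rewrite -memv_row_span; apply: AB; rewrite memv_row_span row_sub.
Qed.

Lemma eq_row_span k l (A : 'M[R]_(k, N)) (B : 'M[R]_(l, N)) :
  (A :=: B)%MS -> row_span A = row_span B.
Proof. by move=> AB; apply/vspaceP => v; rewrite !memv_row_span AB. Qed.

Lemma row_span_row (v : 'rV[R]_N) : row_span v = <[v]>%VS.
Proof. by rewrite /row_span big_ord1 row_id. Qed.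

Lemma row_span_col_mx k l (A : 'M[R]_(k, N)) (B : 'M[R]_(l, N)) :
  row_span (col_mx A B) = (row_span A + row_span B)%VS.
Proof.
rewrite /row_span big_split_ord/=; congr (_ + _)%VS; apply: eq_bigr => i _.
  by rewrite rowKu.
by rewrite rowKd.
Qed.

(** Passing to a row base keeps the span and the rank, and turns the rows into a free family. *)
Lemma dim_row_span k (B : 'M[R]_(k, N)) : \dim (row_span B) = \rank B.
Proof.
rewrite -(eq_row_span (eq_row_base B)); set C := row_base B.
have Cfree : row_free C := row_base_free B.
pose X := [tuple row i C | i < \rank B].
have -> : row_span C = <<X>>%VS.
  by rewrite span_def big_tuple; apply: eq_bigr => i _; rewrite tnth_mktuple.
suff : free X by rewrite /free size_tuple => /eqP.
apply/freeP => c; rewrite (eq_bigr (fun i => c i *: row i C)); last first.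
  by move=> i _; rewrite -tnth_nth tnth_mktuple.
pose d := \row_i c i.
move=> c0; have : d *m C = 0.
  by rewrite mulmx_sum_row -[RHS]c0; apply: eq_bigr => i _; rewrite mxE.
move/eqP; rewrite mulmx_free_eq0// => /eqP d0 i.
by have := congr1 (fun M : 'rV_ _ => M 0 i) d0; rewrite !mxE.
Qed.

Lemma row_span_vbasis (A : psubspace R N) :
  row_span (\matrix_(i < \dim A) (vbasis A)`_i) = A.
Proof.
rewrite -[RHS](span_basis (vbasisP A)) span_def big_tuple.
by apply: eq_bigr => i _; rewrite rowK -tnth_nth.
Qed.

Lemma row_spanP k (A : psubspace R N) : \dim A = k ->
  exists2 B : 'M[R]_(k, N), row_free B & A = row_span B.
Proof.
move=> <-; exists (\matrix_(i < \dim A) (vbasis A)`_i); last by rewrite row_span_vbasis.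
by rewrite /row_free -dim_row_span row_span_vbasis.
Qed.

Lemma dimv_leq (A : psubspace R N) : (\dim A <= N)%N.
Proof. by rewrite -[A]row_span_vbasis dim_row_span rank_leq_col. Qed.

Lemma vlineP_dim1 (x : psubspace R N) : \dim x = 1%N ->
  exists2 v, v != 0 & x = <[v]>%VS.
Proof.
move=> /row_spanP[B Bf ->].
exists B; last by rewrite row_span_row.
by rewrite -mxrank_eq0; move: Bf; rewrite /row_free => /eqP ->.
Qed.

Lemma dim_vline1 (v : 'rV[R]_N) : v != 0 -> \dim <[v]> = 1%N.
Proof. by move=> v0; rewrite dim_vline v0. Qed.

(** Orthogonality to a span is orthogonality to its generators, hence a single matrix equation. *)
Lemma polar_row_span (G : 'M[R]_N) k (B : 'M[R]_(k, N)) :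
  polar G (row_span B) = row_span (kermx (G *m B^T)).
Proof.
apply/vspaceP => x; rewrite memv_row_span; apply/idP/sub_kermxP => [/polarP xB|xB].
  apply/rowP => i; rewrite [RHS]mxE mulmxA.
  have := xB (row i B); rewrite memv_row_span row_sub => /(_ isT).
  by rewrite /bform tr_row => <-; rewrite !mxE; apply: eq_bigr => j _; rewrite !mxE.
apply/polarP => a; rewrite memv_row_span => /submxP[D ->].
by rewrite /bform trmx_mul mulmxA -(mulmxA x) xB mul0mx mxE.
Qed.

Lemma bform0E (G : 'M[R]_N) (x y : 'rV[R]_N) :
  (bform G x y == 0) = (x *m G *m y^T == 0).
Proof.
apply/eqP/eqP => [h|]; last by rewrite /bform => ->; rewrite mxE.
by apply/rowP => i; rewrite (ord1 i) [RHS]mxE.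
Qed.

End row_span.

Section nondegenerate.
Context {R : realType} {N : nat} (G : 'M[R]_N).
Hypotheses (Gu : G \in unitmx) (Gs : G^T = G).
Implicit Types A B : psubspace R N.

Lemma bformC (x y : 'rV[R]_N) : bform G x y = bform G y x.
Proof.
transitivity ((x *m G *m y^T)^T 0 0); first by rewrite mxE.
by rewrite !trmx_mul trmxK Gs mulmxA.
Qed.

Lemma polarC A B : (A <= polar G B)%VS = (B <= polar G A)%VS.
Proof.
have sub C D : (C <= polar G D)%VS -> (D <= polar G C)%VS.
  move=> CD; apply/subvP => d dD; apply/polarP => c cC.
  by rewrite bformC; have /polarP := subvP CD c cC; apply.
by apply/idP/idP => /sub.
Qed.

Lemma dim_polar A : \dim (polar G A) = (N - \dim A)%N.
Proof.
have [B Bf ->] := @row_spanP _ _ _ A erefl.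
rewrite polar_row_span !dim_row_span mxrank_ker; congr (_ - _)%N.
by rewrite eqmxMfull ?row_full_unit// mxrank_tr.
Qed.

(** One inclusion is the symmetry of orthogonality; the dimensions agree because the form is
    nondegenerate. *)
Lemma polarK A : polar G (polar G A) = A.
Proof.
apply/eqP; rewrite eq_sym eqEdim polarC subvv/=.
by rewrite !dim_polar subKn// dimv_leq.
Qed.

Lemma polarS A B : (polar G A <= polar G B)%VS = (B <= A)%VS.
Proof. by rewrite polarC polarK. Qed.

Lemma polarD A B : polar G (A + B)%VS = (polar G A :&: polar G B)%VS.
Proof.
apply/eqP; rewrite eqEsubv; apply/andP; split.
  by rewrite subv_cap !polarS addvSl addvSr.
by rewrite polarC subv_add ![(_ <= polar G (_ :&: _))%VS]polarC capvSl capvSr.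
Qed.

Lemma polar_inj : injective (polar G).
Proof. exact: can_inj polarK. Qed.

End nondegenerate.

Section lorentzian.
Context {R : realType} {n : nat} (G : 'M[R]_n.+2).
Hypothesis lorG : lorentzian G.

Lemma lorentzian_sym : G^T = G.
Proof.
have [P Pu PG] := lorG; have PTu : P^T \in unitmx by rewrite unitmx_tr.
apply: (can_inj (mulKmx Pu)); apply: (can_inj (mulmxK PTu)).
transitivity ((P *m G *m P^T)^T); first by rewrite !trmx_mul trmxK mulmxA.
by rewrite PG tr_diag_mx.
Qed.

Lemma lorentzian_unit : G \in unitmx.
Proof.
have [P Pu PG] := lorG.
suff : P *m G *m P^T \in unitmx by rewrite !unitmx_mul => /andP[/andP[]].
rewrite PG unitmxE det_diag unitfE prodf_seq_neq0; apply/allP => i _ /=.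
by rewrite mxE; case: ifP; rewrite ?oppr_eq0 oner_eq0.
Qed.

Let wd := widen_ord (leqnSn n.+1).

Let q (x y : 'rV[R]_n.+2) :=
  \sum_(i < n.+1) x 0 (wd i) * y 0 (wd i)
  - x 0 ord_max * y 0 ord_max.

(** The coordinates are taken in the basis formed by the rows of [P]; the last one is timelike. *)
Let lorentzian_coord : exists2 Q : 'M[R]_n.+2, Q \in unitmx &
  forall x y, bform G x y = q (x *m Q) (y *m Q).
Proof.
have [P Pu PG] := lorG; exists (invmx P); first by rewrite unitmx_inv.
move=> x y; set x' := x *m _; set y' := y *m _.
have -> : bform G x y = (x' *m (P *m G *m P^T) *m y'^T) 0 0.
  by rewrite /x' /y' trmx_mul trmx_inv !mulmxA mulmxKV// mulmxK ?unitmx_tr.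
clearbody x' y'; rewrite PG mul_mx_diag mxE big_ord_recr/= !mxE eqxx mulrN1 mulNr /q.
congr (_ - _); apply: eq_bigr => i _; rewrite !mxE.
by rewrite ifF ?mulr1// -val_eqE/= ltn_eqF.
Qed.

(** The orthogonal of a null vector is positive semidefinite, with that vector spanning the kernel.
    Beyond symmetry and nondegeneracy, the signature enters the proof only through this fact. *)
Lemma lorentzian_gt0 (x z : 'rV[R]_n.+2) :
  z != 0 -> bform G z z = 0 -> bform G x z = 0 -> ~~ (x <= z)%MS ->
  0 < bform G x x.
Proof.
have [Q Qu qE] := lorentzian_coord; rewrite !qE.
move: x z => x1 z1 z10; have : z1 *m Q != 0.
  by apply: contraNneq z10 => z0; rewrite -(mulmxK Qu z1) z0 mul0mx.
have -> : (x1 <= z1)%MS = (x1 *m Q <= z1 *m Q)%MS.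
  by rewrite submxMfree// row_free_unit.
move: (x1 *m Q) (z1 *m Q) => {z10 z1 x1} x z z0 qzz qxz xz.
have sq_ge0 (y : 'rV[R]_n.+2) :
    0 <= \sum_(i < n.+1) y 0 (wd i) * y 0 (wd i).
  by apply: sumr_ge0 => i _; rewrite -expr2 sqr_ge0.
have sq_eq0 (y : 'rV[R]_n.+2) : y 0 ord_max = 0 ->
    \sum_(i < n.+1) y 0 (wd i) * y 0 (wd i) = 0 ->
    y = 0.
  move=> yl /eqP; rewrite psumr_eq0 => [/allP h|i _]; last by rewrite -expr2 sqr_ge0.
  apply/rowP => i; rewrite mxE; case: (unliftP ord_max i) => [j ->|->//].
  have := h j (mem_index_enum _); rewrite /= -expr2 sqrf_eq0 => /eqP <-.
  by congr (y 0 _); apply/val_inj; rewrite /= /bump leqNgt ltn_ord.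
have zl : z 0 ord_max != 0.
  apply: contra_neq z0 => zl; apply: sq_eq0 => //.
  by move: qzz; rewrite /q zl mulr0 subr0.
(* Removing from [x] its component along [z] kills the timelike coordinate
   and does not change the value of the form. *)
pose c := x 0 ord_max / z 0 ord_max; pose w := x - c *: z.
have wl : w 0 ord_max = 0 by rewrite !mxE /c divfK// subrr.
have qw : q x x = q w w.
  have qD : q w w = q x x - c *+ 2 * q x z + c ^+ 2 * q z z.
    rewrite /q !mulrBr !mulr_sumr.
    transitivity (\sum_(i < n.+1) (x 0 (wd i) * x 0 (wd i)
       - c *+ 2 * (x 0 (wd i) * z 0 (wd i))
       + c ^+ 2 * (z 0 (wd i) * z 0 (wd i)))
       - w 0 ord_max * w 0 ord_max).
      congr (_ - _); apply: eq_bigr => i _; rewrite !mxE; ring.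
    rewrite !big_split/= sumrN !mxE; ring.
  by rewrite qD qxz qzz !mulr0 subr0 addr0.
rewrite qw /q wl mulr0 subr0 lt0r sq_ge0 andbT.
apply: contra xz => /eqP/(sq_eq0 _ wl)/eqP; rewrite subr_eq0 => /eqP ->.
exact: scalemx_sub.
Qed.

(** This puts every point of a generator, the point of contact excepted, in the de Sitter space; it
    is [lorentzian_gt0] read on spanning vectors. *)
Lemma deSitter_polar (x z : psubspace R n.+2) :
  absolute G z -> \dim x = 1%N -> (x <= polar G z)%VS -> x <> z -> deSitter G x.
Proof.
move=> [z1 zz] x1 xz xnz; split=> // v vx v0.
have [z0 z0n zE] := vlineP_dim1 z1.
have z0z : z0 \in z by rewrite zE memv_line.
apply: (@lorentzian_gt0 v z0) => //; first exact: zz.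
  by have /polarP := subvP xz v vx; apply.
apply/negP => vz; apply: xnz.
have xv : x = <[v]>%VS.
  by apply/esym/eqP; rewrite eqEdim -memvE vx x1 dim_vline1.
apply/eqP; rewrite xv zE eqEdim !dim_vline1// leqnn andbT.
by rewrite -!row_span_row row_spanS.
Qed.

Lemma deSitter_neq (x z : psubspace R n.+2) :
  absolute G z -> deSitter G x -> x <> z.
Proof.
move=> [z1 zz] [x1 xx] xz; have [v v0 xE] := vlineP_dim1 x1.
have vx : v \in x by rewrite xE memv_line.
by have := xx v vx v0; rewrite zz ?ltxx// -xz.
Qed.

End lorentzian.

(** * Manifolds, families of subspaces and their tangent spaces *)

Section jet.
Context {R : realType} {m k N : nat}.
Implicit Types (B P Q : 'rV[R]_m -> 'M[R]_(k, N)) (a : 'rV[R]_m) (s t : 'rV[R]_k).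

(** The differential at [(a, s)] of the map [(a, s) |-> s *m B a], as a matrix: the first [k] rows
    are the derivatives in [s], the last [m] those in [a]. The point is regular exactly when this
    matrix is row-free. *)
Definition jet B a s : 'M[R]_(k + m, N) :=
  col_mx (B a) (\matrix_(i < m) (s *m 'D_(delta_mx 0 i) B a)).

Lemma row_span_jet B a s :
  row_span (jet B a s) =
  (row_span (B a) + \sum_(i < m) <[(s *m 'D_(delta_mx 0 i) B a)%R]>)%VS.
Proof.
rewrite row_span_col_mx; congr (_ + _)%VS.
by apply: eq_bigr => i _; rewrite rowK.
Qed.

Lemma jetS l (C : 'M[R]_(l, N)) B a s :
  (jet B a s <= C)%MS = (B a <= C)%MS &&
    [forall i, (s *m 'D_(delta_mx 0 i) B a <= C)%MS].
Proof.
rewrite col_mx_sub; congr (_ && _); apply/row_subP/forallP => h i.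
  by have := h i; rewrite rowK.
by rewrite rowK.
Qed.

Lemma sub_jet_derive B a s i : (s *m 'D_(delta_mx 0 i) B a <= jet B a s)%MS.
Proof.
have : (jet B a s <= jet B a s)%MS by [].
by rewrite {1}jetS => /andP[_ /forallP].
Qed.

Lemma sub_jet B a s : (B a <= jet B a s)%MS.
Proof. by have := submx_refl (jet B a s); rewrite {1}jetS => /andP[]. Qed.

(* Near [a] one has [P = C *m Q] with [C] smooth, so that
   [s *m 'D_v P a = s *m 'D_v C a *m Q a + s *m C a *m 'D_v Q a], where
   [s *m C a] is a multiple of [t]. *)
Lemma jet_le (W : set 'rV[R]_m) P Q a s t :
  open W -> W a -> smooth_on W P -> smooth_on W Q ->
  (forall x, W x -> row_free (Q x) /\ (P x <= Q x)%MS) ->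
  (s *m P a <= t *m Q a)%MS -> (jet P a s <= jet Q a t)%MS.
Proof.
move=> oW Wa sP sQ PQ sPtQ.
have [Qaf PQa] := PQ a Wa.
(* [N0] is a right inverse of [Q a]. Since [Q x *m N0] stays invertible near [a], the coefficients
   of [P x] in the rows of [Q x] are given by a smooth formula. *)
have [N0 QN0] := row_freeP Qaf.
pose W' := W `&` [set x | Q x *m N0 \in unitmx].
have sQN : smooth_on W (fun x => Q x *m N0).
  by apply: smooth_on_mulmx => //; exact: smooth_on_cst.
have oW' : open W' by exact: open_unitmx.
have W'a : W' a by split=> //=; rewrite QN0 unitmx1.
have W'W : W' `<=` W by move=> x [].
pose C x := P x *m N0 *m invmx (Q x *m N0).
have PE x : W' x -> P x = C x *m Q x.
  move=> [Wx /= Qu]; have [_ /submxP[D PD]] := PQ x Wx.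
  by rewrite /C PD -[D *m Q x *m N0]mulmxA mulmxK.
have sC : smooth_on W' C.
  apply: smooth_on_mulmx => //.
    apply: smooth_on_mulmx => //; last exact: smooth_on_cst.
    exact: smooth_onS sP.
  by apply: smooth_on_invmx => //; [move=> x []|exact: smooth_onS sQN].
have dC := smooth_on_differentiable sC W'a.
have dQ := smooth_on_differentiable sQ Wa.
have [c scE] : exists c, s *m C a = c *: t.
  have /sub_rVP[c sE] := sPtQ; exists c; apply: (row_free_inj Qaf).
  by rewrite -mulmxA -PE// sE scalemxAl.
rewrite jetS (submx_trans PQa (sub_jet _ _ _))/=; apply/forallP => i.
rewrite (@near_eq_derive _ _ _ P (fun x => C x *m Q x)); last first.
  by near=> x; apply: PE; near: x; exact: open_nbhs_nbhs.
rewrite derive_mulmx// mulmxDr; apply: addmx_sub.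
  by rewrite mulmxA; apply: submx_trans (sub_jet _ _ _); exact: submxMl.
by rewrite (mulmxA s (C a)) scE -scalemxAl; apply/scalemx_sub/sub_jet_derive.
Unshelve. all: by end_near. Qed.

End jet.

Section jet_comp.
Context {R : realType} {m m' k N : nat}.

(** The chain rule writes the partial derivatives of [B \o g] as combinations of those of [B]. Only
    an inclusion results, since the differential of [g] is arbitrary. *)
Lemma jet_comp (B : 'rV[R]_m' -> 'M[R]_(k, N)) (g : 'rV[R]_m -> 'rV[R]_m') a s :
  differentiable g a -> differentiable B (g a) ->
  (jet (B \o g) a s <= jet B (g a) s)%MS.
Proof.
move=> dg dB; rewrite jetS sub_jet/=; apply/forallP => i.
rewrite derive_comp_row// mulmx_sumr; apply: summx_sub => j _.
by rewrite -scalemxAr; apply/scalemx_sub/sub_jet_derive.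
Qed.

End jet_comp.

Section manifolds.
Context {R : realType} {m : nat}.
Implicit Types M : manifold R m.

Lemma smooth_map_id M : smooth_map (id : M -> M).
Proof.
by case: M => ? ? ? ? ? ? idM c c' cM c'M; exact: (idM c c' cM c'M).
Qed.

Lemma atlas_cover M (u : M) : exists c a, [/\ atlas c, dom c a & par c a = u].
Proof. by case: M u => ? ? ? ? ? cover ? u; exact: (cover u). Qed.

Lemma atlas_homeo M (c : chart R m M) : atlas c -> chart_homeo c.
Proof. by case: M c => ? ? ? ? homeo ? ? c cM; exact: (homeo c cM). Qed.

Lemma par_inj M (c : chart R m M) a b : atlas c -> dom c a -> dom c b ->
  par c a = par c b -> a = b.
Proof. by move=> /atlas_homeo[_ + _] da db; apply; rewrite inE. Qed.

Lemma smooth_map_comp M M' M'' (h : M -> M') (h' : M' -> M'') :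
  smooth_map h -> smooth_map h' -> smooth_map (h' \o h).
Proof.
move=> sh sh' c c'' cM cM'' a b da db /= hab.
have [c' [a' [cM' da' ha']]] := atlas_cover (h (par c a)).
have [W [g [oW Wa Wc sg hg]]] := sh _ _ cM cM' a a' da da' (esym ha').
(* Charts are injective, so [g a] is the coordinate of the intermediate point and lies in the domain
   [W'] of [g']. *)
have ga : g a = a'.
  by have [dga hga] := hg a Wa; apply: (par_inj cM') => //; rewrite -hga ha'.
have [W' [g' [oW' Wa' Wc' sg' hg']]] :=
  sh' _ _ cM' cM'' a' b da' db (etrans (congr1 h' ha') hab).
have oWg : open (W `&` g @^-1` W').
  by apply: open_setI_preimage => // x; exact: smooth_on_continuous sg.
exists (W `&` g @^-1` W'), (g' \o g); split=> //.
- by split=> //=; rewrite ga.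
- by move=> x [/Wc].
- apply: (smooth_on_comp oWg oW') => //; first by move=> x [].
  by apply: smooth_onS sg => x [].
- move=> x [Wx W'gx]; have [dgx hgx] := hg x Wx; have [dg'x hg'x] := hg' _ W'gx.
  by split=> //=; rewrite hgx hg'x.
Qed.

Lemma diffeomorphism_id M : diffeomorphism (id : M -> M).
Proof. by exists id; split=> //; exact: smooth_map_id. Qed.

Lemma diffeomorphism_comp M M' M'' (h : M -> M') (h' : M' -> M'') :
  diffeomorphism h -> diffeomorphism h' -> diffeomorphism (h' \o h).
Proof.
move=> [g [hK gK sh sg]] [g' [h'K g'K sh' sg']]; exists (g \o g'); split.
- exact: can_comp.
- exact: can_comp.
- exact: smooth_map_comp.
- exact: smooth_map_comp.
Qed.

End manifolds.

Section families.
Context {R : realType} {m N : nat}.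
Implicit Types M : manifold R m.

(** The frame is read through the coordinate expression [g] of [h], where [g] takes values in [W'].
    With [h] the identity this is a change of charts. *)
Lemma local_frame_pullback k M M' (h : M -> M') (F : M -> psubspace R N)
    (F' : M' -> psubspace R N) c c' W' (B : 'rV[R]_m -> 'M[R]_(k, N)) a a' :
  smooth_map h -> (forall u, F' (h u) = F u) ->
  atlas c -> dom c a -> h (par c a) = par c' a' ->
  local_frame F' c' W' B -> W' a' ->
  exists W g, [/\ W a, g a = a', smooth_on W g, (forall x, W x -> W' (g x)) &
    local_frame F c W (B \o g)].
Proof.
move=> sh FF cM da ha [cM' oW' W'c' sB fB] W'a'.
have [W [g [oW Wa Wc sg hg]]] := sh _ _ cM cM' a a' da (W'c' _ W'a') ha.
have ga : g a = a'.
  have [dga hga] := hg a Wa; apply: (par_inj cM') => //; first exact: W'c'.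
  by rewrite -hga ha.
have oWg : open (W `&` g @^-1` W').
  by apply: open_setI_preimage => // x; exact: smooth_on_continuous sg.
have sWg : smooth_on (W `&` g @^-1` W') g by apply: smooth_onS sg => x [].
exists (W `&` g @^-1` W'), g; split=> //.
- by split=> //=; rewrite ga.
- by move=> x [].
- split=> //; first by move=> x [/Wc].
  + by apply: (smooth_on_comp oWg oW') => // x [].
  + move=> x [Wx W'gx]; have [dgx hgx] := hg x Wx; have [? <-] := fB _ W'gx.
    by split=> //; rewrite -hgx FF.
Qed.

Lemma smooth_familyP k M (F : M -> psubspace R N) :
  (forall u, exists c W (B : 'rV[R]_m -> 'M[R]_(k, N)) a,
     [/\ local_frame F c W B, W a & par c a = u]) ->
  smooth_family k F.
Proof.
move=> H c a cM da; have [c' [W' [B [a' [fB W'a' a'E]]]]] := H (par c a).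
have [W [g [Wa _ _ _ fW]]] :=
  local_frame_pullback (@smooth_map_id _ _ M) (fun=> erefl) cM da (esym a'E) fB W'a'.
by exists W, (B \o g).
Qed.

Lemma tangent_spaceP k M (F : M -> psubspace R N) u x T :
  tangent_space k F u x T <-> exists c W (B : 'rV[R]_m -> 'M[R]_(k, N)) a s,
    [/\ local_frame F c W B, W a /\ par c a = u, s != 0 /\ x = <[s *m B a]>%VS &
        T = row_span (jet B a s)].
Proof.
by split=> -[c [W [B [a [s [? ? ? TE]]]]]]; exists c, W, B, a, s; split=> //;
   rewrite TE row_span_jet.
Qed.

Lemma tangent_space_exists k M (F : M -> psubspace R N) u x :
  smooth_family k F -> \dim x = 1%N -> (x <= F u)%VS ->
  exists T, tangent_space k F u x T.
Proof.
move=> sF x1 xF; have [c [a [cM da au]]] := atlas_cover u.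
have [W [B [Wa fB]]] := sF c a cM da.
have [v v0 xE] := vlineP_dim1 x1; have [_ _ _ _ /(_ a Wa)[Bf FB]] := fB.
move: xF; rewrite xE -au FB -memvE memv_row_span => /submxP[s vE].
exists (row_span (jet B a s)); apply/tangent_spaceP; exists c, W, B, a, s.
split=> //; rewrite -vE; split=> //.
by apply: contraNneq v0 => s0; rewrite vE s0 mul0mx.
Qed.

Lemma tangent_space_point k M (F : M -> psubspace R N) u x T :
  tangent_space k F u x T -> \dim x = 1%N /\ (x <= F u)%VS.
Proof.
move=> [c [W [B [a [s [[_ _ _ _ fB] [Wa <-] [s0 ->] _]]]]]].
have [Bf ->] := fB a Wa; rewrite dim_vline1 ?mulmx_free_eq0//; split=> //.
by rewrite -row_span_row row_spanS submxMl.
Qed.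

Lemma tangent_space_sub k M (F : M -> psubspace R N) u x T :
  tangent_space k F u x T -> (F u <= T)%VS.
Proof.
move=> [c [W [B [a [s [[_ _ _ _ fB] [Wa <-] _ ->]]]]]].
by have [_ ->] := fB a Wa; exact: addvSl.
Qed.

(** [B] and [B' \o g] frame the same family, so [jet_le] compares their jets, and [jet_comp] passes
    from [B' \o g] to [B']. Taking [h] to be the identity gives uniqueness of tangent spaces; a
    diffeomorphism and its inverse give their invariance. *)
Lemma tangent_space_le k M M' (h : M -> M') (F : M -> psubspace R N)
    (F' : M' -> psubspace R N) u x T T' :
  smooth_map h -> (forall u, F' (h u) = F u) ->
  tangent_space k F u x T -> tangent_space k F' (h u) x T' -> (T <= T')%VS.
Proof.
move=> sh FF /tangent_spaceP[c [W [B [a [s [fB [Wa au] [s0 xE] ->]]]]]].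
move=> /tangent_spaceP[c' [W' [B' [a' [t [fB' [W'a' a'u] [t0 xE'] ->]]]]]].
have [cM oW Wc sB FB] := fB; have [_ _ _ sB' _] := fB'.
have ha : h (par c a) = par c' a' by rewrite au a'u.
have [W1 [g [W1a ga sg gW' [_ oW1 _ sB'g FB'g]]]] :=
  local_frame_pullback sh FF cM (Wc _ Wa) ha fB' W'a'.
rewrite row_spanS; apply: (@submx_trans _ _ _ _ _ _ (jet (B' \o g) a t)); last first.
  rewrite -ga; apply: jet_comp; first exact: smooth_on_differentiable sg _.
  by apply: (smooth_on_differentiable sB'); rewrite ga.
apply: (@jet_le _ _ _ _ (W `&` W1)) => //.
- exact: openI.
- by apply: smooth_onS sB => y [].
- by apply: smooth_onS sB'g => y [].
- move=> y [Wy W1y]; have [_ FBy] := FB y Wy; have [B'f FB'y] := FB'g y W1y.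
  by split=> //; rewrite -row_spanS -FBy -FB'y.
- by rewrite -row_spanS !row_span_row -xE /= ga xE'.
Qed.

Lemma tangent_space_uniq k M (F : M -> psubspace R N) u x T T' :
  tangent_space k F u x T -> tangent_space k F u x T' -> T = T'.
Proof.
move=> hT hT'; apply/eqP; rewrite eqEsubv.
rewrite (tangent_space_le (@smooth_map_id _ _ M) (fun=> erefl) hT hT').
exact: (tangent_space_le (@smooth_map_id _ _ M) (fun=> erefl) hT' hT).
Qed.

Lemma tangent_space_transport k M M' (h : M -> M') (F : M -> psubspace R N)
    (F' : M' -> psubspace R N) u x T :
  diffeomorphism h -> (forall u, F' (h u) = F u) -> smooth_family k F' ->
  tangent_space k F u x T -> tangent_space k F' (h u) x T.
Proof.
move=> [h' [hK h'K sh sh']] FF sF' hT; have [x1 xF] := tangent_space_point hT.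
have [|T' hT'] := @tangent_space_exists k _ F' (h u) x sF' x1; first by rewrite FF.
suff -> : T = T' by [].
apply/eqP; rewrite eqEsubv (tangent_space_le sh FF hT hT')/=.
have FF' v : F (h' v) = F' v by rewrite -FF h'K.
by apply: (tangent_space_le sh' FF' hT'); rewrite hK.
Qed.

Lemma jet_mulmx k (A : 'M[R]_N) (B : 'rV[R]_m -> 'M[R]_(k, N)) a s :
  differentiable B a -> jet (fun x => B x *m A) a s = jet B a s *m A.
Proof.
move=> dB; rewrite /jet mul_col_mx; congr col_mx; apply/row_matrixP => i.
by rewrite row_mul !rowK derive_mulmxr// mulmxA.
Qed.

Lemma local_frame_mulmx k (A : 'M[R]_N) M (F F' : M -> psubspace R N) c W
    (B : 'rV[R]_m -> 'M[R]_(k, N)) :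
  A \in unitmx ->
  (forall u (B : 'M[R]_(k, N)), F u = row_span B -> F' u = row_span (B *m A)) ->
  local_frame F c W B -> local_frame F' c W (fun x => B x *m A).
Proof.
move=> Au FF [cM oW Wc sB fB]; split=> //.
  by apply: smooth_on_mulmx => //; exact: smooth_on_cst.
move=> x Wx; have [Bf FB] := fB x Wx; split; last exact: FF.
by rewrite /row_free mxrankMfree ?row_free_unit.
Qed.

(** A constant invertible factor multiplies the jets on the right and keeps their rank. Used with
    [G] and [invmx G], it links a point of the absolute with the dual coordinates of its tangent
    hyperplane. *)
Lemma rank_at_mulmx (A : 'M[R]_N) M (F F' : M -> psubspace R N) u r :
  A \in unitmx ->
  (forall u (B : 'rV[R]_N), F u = row_span B -> F' u = row_span (B *m A)) ->
  rank_at F u r -> rank_at F' u r.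
Proof.
move=> Au FF [T [/tangent_spaceP[c [W [B [a [s [fB [Wa au] [s0 FE] ->]]]]]] rT]].
have [cM oW Wc sB FB] := fB; have dB := smooth_on_differentiable sB Wa.
exists (row_span (jet (fun x => B x *m A) a s)); split.
  apply/tangent_spaceP; exists c, W, (fun x => B x *m A), a, s; split=> //.
    exact: local_frame_mulmx fB.
  by split=> //; rewrite mulmxA -row_span_row; apply: FF; rewrite row_span_row.
by rewrite jet_mulmx// -rT !dim_row_span mxrankMfree ?row_free_unit.
Qed.

End families.

Section same_family.
Context {R : realType} {n : nat}.
Implicit Types F : subspace_family R n.

Lemma same_family_refl F : same_family F F.
Proof. by exists id; split=> //; exact: diffeomorphism_id. Qed.

Lemma same_family_sym F F' : same_family F F' -> same_family F' F.
Proof.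
move=> [h [[h' [hK h'K sh sh']] FF]]; exists h'; split; first by exists h; split.
by move=> u; rewrite -FF h'K.
Qed.

Lemma same_family_trans F F' F'' :
  same_family F F' -> same_family F' F'' -> same_family F F''.
Proof.
move=> [h [dh FF]] [h' [dh' FF']]; exists (h' \o h); split.
  exact: diffeomorphism_comp.
by move=> u /=; rewrite FF' FF.
Qed.

Lemma family_classP F F' : family_class F = family_class F' <-> same_family F F'.
Proof.
split=> [eqF|FF]; first by rewrite -/(family_class F F') eqF; exact: same_family_refl.
apply/funext => E; apply/propext; split; apply: same_family_trans => //.
exact: same_family_sym.
Qed.

End same_family.

(** * Linear algebra and differentiation of orthogonality relations *)

Section linear_algebra.
Context {R : realType}.

Lemma dim_addv_lines N (x z : psubspace R N) :
  \dim x = 1%N -> \dim z = 1%N -> x <> z -> \dim (x + z)%VS = 2.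
Proof.
move=> x1 z1 xz; rewrite dimv_disjoint_sum ?x1 ?z1//.
apply/eqP; rewrite -dimv_eq0.
have : (\dim (x :&: z) <= 1)%N by rewrite (leq_trans (dimvS (capvSl x z))) ?x1.
rewrite leq_eqVlt ltnS leqn0 => /orP[/eqP dimE|//]; exfalso; apply: xz.
have xc : (x :&: z)%VS = x by apply/eqP; rewrite eqEdim capvSl dimE x1.
by apply/eqP; rewrite eqEdim x1 z1 andbT -xc capvSr.
Qed.

Lemma row_free_complete p q (A : 'M[R]_(q, p + q)) : row_free A ->
  exists C : 'M[R]_(p, p + q), col_mx C A \in unitmx.
Proof.
move=> Af; have Aq : \rank A = q by apply/eqP.
have [|C Cf CE] := @row_spanP _ _ p (row_span A^C%MS).
  by rewrite dim_row_span mxrank_compl Aq addnK.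
exists C; rewrite -row_full_unit -sub1mx -addsmxE.
have : (1%:M <= A + A^C)%MS by rewrite sub1mx addsmx_compl_full.
move=> /submx_trans; apply; rewrite addsmx_sub addsmxSr/=.
apply: submx_trans (addsmxSl _ _).
by rewrite -row_spanS CE.
Qed.

(** Up to the factor [\det g], the determinant of [A + t *: g] is the value at [t] of a
    characteristic polynomial, and a nonzero polynomial does not vanish on all of [R]. *)
Lemma exists_unitmx_shift m (A g : 'M[R]_m) : g \in unitmx ->
  exists t, A + t *: g \in unitmx.
Proof.
move=> gu; pose p := char_poly (- (A *m invmx g)).
have p0 : p != 0 by rewrite monic_neq0 ?char_poly_monic.
have [t pt] : exists t, p.[t] != 0.
  apply/not_existsP => rootp.
  (* These are [size p] distinct numbers, one more than the degree allows for roots. *)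
  pose rs := [seq i%:R : R | i <- iota 0 (size p)].
  have rs_root : all (root p) rs by apply/allP => x _; apply: contraT => /rootp.
  have rs_uniq : uniq rs.
    by rewrite map_inj_uniq ?iota_uniq//; exact: (mulrIn (oner_neq0 R)).
  have := max_poly_roots p0 rs_root rs_uniq.
  by rewrite size_map size_iota ltnn.
exists t; rewrite -(mulmxKV gu (A + _)) unitmx_mul gu andbT.
rewrite mulmxDl -scalemxAl mulmxV// -row_free_unit -kermx_eq0.
move: pt; rewrite -[_ != 0]/(~~ root p t) -eigenvalue_root_char negbK.
rewrite /eigenspace -opprD => /eqP kerN.
rewrite -submx0 -kerN; apply/sub_kermxP.
by rewrite scalemx1 mulmxN mulmx_ker oppr0.
Qed.

Lemma form_entry N k l (G : 'M[R]_N) (A : 'M[R]_(k, N)) (B : 'M[R]_(l, N)) i j :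
  (A *m G *m B^T) i j = bform G (row i A) (row j B).
Proof. by rewrite /bform !mxE; apply: eq_bigr => h _; rewrite -row_mul !mxE. Qed.

End linear_algebra.

Section derive_orthogonal.
Context {R : realType} {V : normedModType R} {N : nat}.

Lemma smooth_on_trmx (D : set V) p q (f : V -> 'M[R]_(p, q)) : open D ->
  smooth_on D f -> smooth_on D (fun x => (f x)^T).
Proof.
move=> oD /smooth_on_mxP-/(_ oD) sf; apply/smooth_on_mxP => // i j.
by apply: smooth_on_eq (sf j i) => // x _; rewrite mxE.
Qed.

Lemma derive_trmx p q (f : V -> 'M[R]_(p, q)) x v : differentiable f x ->
  'D_v (fun y => (f y)^T) x = ('D_v f x)^T.
Proof.
move=> df; have dij := (differentiable_mxP _ _).1 df.
have dfT : differentiable (fun y => (f y)^T) x.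
  apply/differentiable_mxP => i j.
  by rewrite (_ : (fun y => _) = fun y => f y j i)//; apply/funext => y; rewrite mxE.
apply/matrixP => i j; rewrite [RHS]mxE -!derive_coord//.
by congr ('D_v _ x); apply/funext => y; rewrite mxE.
Qed.

(** The product rule applied to a constant zero pairing moves a derivative from one factor to the
    other, at the cost of a sign. *)
Lemma derive_orthogonal (G : 'M[R]_N) p q (W : set V) (P : V -> 'M[R]_(p, N))
    (Q : V -> 'M[R]_(q, N)) x v :
  open W -> smooth_on W P -> smooth_on W Q -> W x ->
  (forall y, W y -> P y *m G *m (Q y)^T = 0) ->
  P x *m G *m ('D_v Q x)^T = - ('D_v P x *m G *m (Q x)^T).
Proof.
move=> oW sP sQ Wx PQ.
have dP := smooth_on_differentiable sP Wx; have dQ := smooth_on_differentiable sQ Wx.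
have : 'D_v (fun y => P y *m G *m (Q y)^T) x = 0.
  rewrite -[RHS](derive_cst (0 : 'M[R]_(p, q)) x v); apply: near_eq_derive.
  by near=> y; apply: PQ; near: y; exact: open_nbhs_nbhs.
have sPG : smooth_on W (fun y => P y *m G).
  by apply: smooth_on_mulmx => //; exact: smooth_on_cst.
rewrite derive_mulmx//; last 2 first.
- exact: smooth_on_differentiable sPG Wx.
- exact: smooth_on_differentiable (smooth_on_trmx oW sQ) Wx.
rewrite derive_trmx// derive_mulmxr// addrC => /eqP.
by rewrite addr_eq0 => /eqP.
Unshelve. all: by end_near. Qed.

End derive_orthogonal.

Lemma smooth_on_jet (R : realType) m k N (W : set 'rV[R]_m)
    (B : 'rV[R]_m -> 'M[R]_(k, N)) (s : 'rV[R]_k) :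
  open W -> smooth_on W B -> smooth_on W (fun x => jet B x s).
Proof.
move=> oW sB; apply/smooth_on_mxP => // i j.
rewrite /jet; case: (split_ordP i) => i' ->.
  by apply: smooth_on_eq ((smooth_on_mxP _ oW).1 sB i' j) => // x _; rewrite col_mxEu.
have sD : smooth_on W (fun x => s *m 'D_(delta_mx 0 i') B x).
  by apply: smooth_on_mulmx => //; [exact: smooth_on_cst|exact: smooth_on_derive].
apply: smooth_on_eq ((smooth_on_mxP _ oW).1 sD 0 j) => // x _.
by rewrite col_mxEd [RHS]mxE.
Qed.

(** * Hypersurfaces of the absolute and families of lines *)

Section geometry.
Context {R : realType} {m : nat} (G : 'M[R]_m.+3) (M : manifold R m).
Hypothesis lorG : lorentzian G.
Implicit Types (F U V : M -> psubspace R m.+3) (u : M).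

Let Gs : G^T = G := lorentzian_sym lorG.
Let Gu : G \in unitmx := lorentzian_unit lorG.

(** Here [n] is [m.+1], so that [n.-1] reduces to [m], the dimension of [M]. *)
Definition hypersurface V := @SubspaceFamily R m.+1 M V.

Lemma sub_polar_row_span k l (A : 'M[R]_(k, m.+3)) (B : 'M[R]_(l, m.+3)) :
  (row_span A <= polar G (row_span B))%VS = (A *m G *m B^T == 0).
Proof.
by rewrite polar_row_span row_spanS -mulmxA; apply/sub_kermxP/eqP.
Qed.

Lemma trmx_form k l (A : 'M[R]_(k, m.+3)) (B : 'M[R]_(l, m.+3)) :
  (A *m G *m B^T)^T = B *m G *m A^T.
Proof. by rewrite !trmx_mul trmxK Gs mulmxA. Qed.

Lemma absolute_sub_polar (z : psubspace R m.+3) :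
  absolute G z -> (z <= polar G z)%VS.
Proof.
move=> [z1 zz]; have [v v0 zE] := vlineP_dim1 z1.
have vz : v \in z by rewrite zE memv_line.
by rewrite zE -row_span_row sub_polar_row_span -bform0E zz.
Qed.

Section tangent_space_of_V.
Variable V : M -> psubspace R m.+3.
Hypothesis confV : conformal_hypersurface G (hypersurface V).

Let sV : smooth_family 1 V. Proof. by case: confV. Qed.
Let absV u : absolute G (V u). Proof. by case: confV. Qed.

Lemma conformal_tangent_space u : exists T, tangent_space 1 V u (V u) T.
Proof. by have [_ _ /(_ u)[T [hT _]]] := confV; exists T. Qed.

Lemma dim_conformal_tangent_space u T :
  tangent_space 1 V u (V u) T -> \dim T = m.+1.
Proof.
move=> hT; have [_ _ /(_ u)[T' [hT' rT']]] := confV.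
by rewrite (tangent_space_uniq hT hT').
Qed.

(** By uniqueness of the tangent space any frame computes it. For [k = 1] the parameter [s] is a
    scalar, and [1%:M] stands for the point [V u] itself. *)
Lemma conformal_frame u c W (b : 'rV[R]_m -> 'rV[R]_m.+3) a T :
  local_frame V c W b -> W a -> par c a = u -> tangent_space 1 V u (V u) T ->
  T = row_span (jet b a 1%:M).
Proof.
move=> fb Wa au hT; apply: (tangent_space_uniq hT).
apply/tangent_spaceP; exists c, W, b, a, 1%:M; split=> //.
have [_ _ _ _ /(_ a Wa)[_]] := fb; rewrite au => ->.
by rewrite row_span_row mul1mx; split=> //; exact: oner_neq0.
Qed.

Lemma conformal_frame_null c W (b : 'rV[R]_m -> 'rV[R]_m.+3) a :
  local_frame V c W b -> W a -> b a *m G *m (b a)^T = 0.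
Proof.
move=> [_ _ _ _ fb] Wa; have [_ VE] := fb a Wa.
by apply/eqP; rewrite -sub_polar_row_span -VE; exact: absolute_sub_polar.
Qed.

(** Differentiating [(b, b) = 0] gives twice this product. *)
Lemma conformal_frame_derive c W (b : 'rV[R]_m -> 'rV[R]_m.+3) a v :
  local_frame V c W b -> W a -> 'D_v b a *m G *m (b a)^T = 0.
Proof.
move=> fb Wa; have [_ oW _ sb _] := fb.
have := derive_orthogonal v oW sb sb Wa (fun y => conformal_frame_null fb).
have -> : b a *m G *m ('D_v b a)^T = 'D_v b a *m G *m (b a)^T.
  apply/rowP => i; rewrite (ord1 i); exact: bformC.
move=> /eqP; rewrite -addr_eq0 -mulr2n => /eqP h.
apply/eqP; have : (2%:R : R) *: ('D_v b a *m G *m (b a)^T) == 0.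
  by rewrite scaler_nat h.
by rewrite scaler_eq0 pnatr_eq0.
Qed.

Lemma conformal_tangent_sub_polar u T :
  tangent_space 1 V u (V u) T -> (T <= polar G (V u))%VS.
Proof.
move=> hT; have [c [a [cM da au]]] := atlas_cover u.
have [W [b [Wa fb]]] := sV cM da.
have [_ _ _ _ /(_ a Wa)[_ VE]] := fb.
rewrite (conformal_frame fb Wa au hT) -au VE polar_row_span row_spanS jetS.
apply/andP; split; first by apply/sub_kermxP; rewrite mulmxA (conformal_frame_null fb).
apply/forallP => i; apply/sub_kermxP.
by rewrite mul1mx mulmxA (conformal_frame_derive _ fb).
Qed.

Lemma conformal_sub_polar_tangent u T :
  tangent_space 1 V u (V u) T -> (V u <= polar G T)%VS.
Proof. by move=> /conformal_tangent_sub_polar; rewrite (polarC Gs). Qed.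

Lemma dim_polar_tangent u T :
  tangent_space 1 V u (V u) T -> \dim (polar G T) = 2.
Proof.
by move=> hT; rewrite (dim_polar Gu) (dim_conformal_tangent_space hT) subSS -addn2 addKn.
Qed.

Lemma dim_polar_point u : \dim (polar G (V u)) = m.+2.
Proof. by have [V1 _] := absV u; rewrite (dim_polar Gu) V1 subn1. Qed.

Lemma polar_tangent_addv u T x :
  tangent_space 1 V u (V u) T -> \dim x = 1%N -> x <> V u ->
  (x <= polar G T)%VS -> polar G T = (x + V u)%VS.
Proof.
move=> hT x1 xV xT; have [V1 _] := absV u; apply/esym/eqP.
rewrite eqEdim (dim_polar_tangent hT) (dim_addv_lines x1 V1 xV) leqnn andbT.
by rewrite subv_add xT conformal_sub_polar_tangent.
Qed.

(** Tangency of the hypersphere with pole [x] says that [T] is the polar of [x + V u]; taking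
    polars, that [polar G T] is the line joining [x] to [V u]. Conversely, any point of this line
    other than [V u] spans it together with [V u]. *)
Lemma tangent_pencil_polar u T : tangent_space 1 V u (V u) T ->
  tangent_pencil G (hypersurface V) u = points_of (polar G T).
Proof.
move=> hT; have [V1 _] := absV u; apply/seteqP; split=> x /=.
  case=> [->|[dSx _ hT']]; first by split=> //; exact: conformal_sub_polar_tangent.
  have [x1 _] := dSx; split=> //.
  by rewrite (tangent_space_uniq hT hT') -(polarD Gu Gs) (polarK Gu Gs) addvSl.
move=> [x1 xT]; have [->|xV] := pselect (x = V u); first by left.
right; have TE := polar_tangent_addv hT x1 xV xT.
have xVu : (x <= polar G (V u))%VS.
  apply: subv_trans xT _; rewrite (polarS Gu Gs).
  exact: tangent_space_sub hT.
split; first exact: deSitter_polar (absV u) x1 xVu xV.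
  by split; [exact: absV|rewrite (polarC Gs)].
by rewrite -(polarD Gu Gs) -TE (polarK Gu Gs).
Qed.

Section generators.
Variable U : M -> psubspace R m.+3.
Hypotheses (sU : smooth_family 2 U) (UV : forall u, (U u <= polar G (V u))%VS).

(* Both sides say that the derivatives of [U] at [x] are orthogonal to [V u],
   resp. that [x] is orthogonal to the derivatives of [V]; they are exchanged
   by differentiating the orthogonality of [U] and [V]. *)
Lemma generator_tangent_sub_polar u x eta T :
  tangent_space 2 U u x eta -> tangent_space 1 V u (V u) T ->
  (eta <= polar G (V u))%VS = (x <= polar G T)%VS.
Proof.
move=> /tangent_spaceP[c [W' [B [a [s [fB [W'a au] [s0 ->] ->]]]]]] hT.
have [cM oW' W'c sB UB] := fB.
have [W'' [b [W''a fb]]] := sV cM (W'c _ W'a).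
have [_ oW'' _ sb Vb] := fb.
pose W := W' `&` W''; have oW : open W by exact: openI.
have Wa : W a by [].
have Bb y : W y -> B y *m G *m (b y)^T = 0.
  move=> [W'y W''y]; apply/eqP; rewrite -sub_polar_row_span.
  by have [_ <-] := UB y W'y; have [_ <-] := Vb y W''y.
have sBW : smooth_on W B by apply: smooth_onS sB => y [].
have sbW : smooth_on W b by apply: smooth_onS sb => y [].
have DBb i := derive_orthogonal (delta_mx 0 i) oW sBW sbW Wa Bb.
rewrite (conformal_frame fb W''a au hT) -au; have [_ ->] := Vb a W''a.
rewrite -row_span_row (polarC Gs (row_span (s *m B a))) !polar_row_span !row_spanS.
rewrite !jetS; have -> : (B a <= kermx (G *m (b a)^T))%MS.
  by apply/sub_kermxP; rewrite mulmxA Bb.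
have -> : (b a <= kermx (G *m (s *m B a)^T))%MS.
  apply/sub_kermxP; apply: trmx_inj; rewrite mulmxA trmx_form trmx0.
  by rewrite -!mulmxA (mulmxA (B a)) Bb// mulmx0.
apply: eq_forallb => i; rewrite mul1mx.
(* By [DBb], the two conditions at index [i] concern the same product, up to sign and
   transposition. *)
apply: (sameP sub_kermxP); apply: (iffP sub_kermxP); rewrite !mulmxA;
  rewrite -(trmx_form (s *m B a)); have -> : s *m B a *m G *m ('D_(delta_mx 0 i) b a)^T =
    - (s *m 'D_(delta_mx 0 i) B a *m G *m (b a)^T) by
    rewrite -!mulmxA -mulmxN; congr (s *m _); rewrite !mulmxA.
  by move=> /(congr1 trmx)/eqP; rewrite trmxK trmx0 oppr_eq0 => /eqP.
by move=> ->; rewrite oppr0 trmx0.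
Qed.

End generators.
End tangent_space_of_V.
End geometry.

(** * Lines polar to the tangent spaces of a hypersurface *)

Section polar_family.
Context {R : realType} {m : nat} (G : 'M[R]_m.+3) (M : manifold R m).
Hypothesis lorG : lorentzian G.
Variables (V T : M -> psubspace R m.+3).
Hypothesis confV : conformal_hypersurface G (hypersurface V).
Hypothesis VT : forall u, tangent_space 1 V u (V u) (T u).

Let Gs : G^T = G := lorentzian_sym lorG.
Let Gu : G \in unitmx := lorentzian_unit lorG.
Let sV : smooth_family 1 V. Proof. by case: confV. Qed.
Let absV u : absolute G (V u). Proof. by case: confV. Qed.

Let U u := polar G (T u).

(* A frame of the left kernel of a matrix is read off the inverse of any
   invertible matrix extending it, which is smooth. *)
Lemma smooth_polar_family : smooth_family 2 U.
Proof.
move=> c a cM da; have [W [b [Wa fb]]] := sV cM da.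
have [_ oW Wc sb Vb] := fb.
pose K x := jet b x 1%:M *m G.
have TK x : W x -> T (par c x) = row_span (jet b x 1%:M).
  by move=> Wx; exact: (conformal_frame fb Wx erefl (VT _)).
have Kf x : W x -> row_free (K x).
  move=> Wx; rewrite /row_free mxrankMfree ?row_free_unit// -dim_row_span -TK//.
  by rewrite (dim_conformal_tangent_space confV (VT _)).
have sK : smooth_on W K.
  by apply: smooth_on_mulmx => //; [exact: smooth_on_jet|exact: smooth_on_cst].
have [C CKa] := @row_free_complete R 2 (1 + m) (K a) (Kf a Wa).
pose Q x : 'M[R]_(2 + (1 + m)) := col_mx C (K x).
have sQ : smooth_on W Q.
  apply/smooth_on_mxP => // i j; rewrite /Q; case: (split_ordP i) => i' ->.
    by apply: smooth_on_eq (@smooth_on_cst _ _ _ W (C i' j)) => // x _; rewrite col_mxEu.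
  by apply: smooth_on_eq ((smooth_on_mxP _ oW).1 sK i' j) => // x _; rewrite col_mxEd.
pose W' := W `&` [set x | Q x \in unitmx].
have oW' : open W' by exact: open_unitmx.
have W'W : W' `<=` W by move=> x [].
(* The first two columns of the inverse of [Q x], transposed. Multiplied by [C] these columns give
   the identity, whence row-freeness, and by [K x] they give zero. *)
pose B x : 'M[R]_(2, m.+3) := (lsubmx (invmx (Q x)))^T.
have QB x : W' x -> C *m (B x)^T = 1%:M /\ K x *m (B x)^T = 0.
  move=> [_ /= Qu]; apply: eq_col_mx; rewrite -mul_col_mx trmxK -/(Q x).
  by rewrite mulmx_lsub mulmxV// scalar_mx_block /block_mx
    -block_mxEv block_mxEh row_mxKl.
exists W', B; split; first by split.
split=> //; first by move=> x /W'W/Wc.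
  apply: smooth_on_trmx => //; apply/smooth_on_mxP => // i j.
  have sQi : smooth_on W' (fun x => invmx (Q x)).
    by apply: (smooth_on_invmx oW' _ (smooth_onS W'W sQ)) => x [].
  by apply: smooth_on_eq ((smooth_on_mxP _ oW').1 sQi i (lshift _ j)) => // x _;
    rewrite !mxE.
move=> x W'x; have Wx := W'W x W'x; have [CB KB] := QB x W'x.
have Bf : row_free (B x).
  by apply/row_freeP; exists C^T; rewrite -[LHS]trmxK trmx_mul trmxK CB trmx1.
split=> //; apply/esym/eqP; rewrite eqEdim /U TK// sub_polar_row_span.
rewrite -[X in _ && (X <= _)%N](congr1 (fun T => \dim (polar G T)) (TK x Wx)).
rewrite (dim_polar_tangent lorG confV (VT _)) dim_row_span (eqP Bf) andbT.
by apply/eqP/trmx_inj; rewrite (trmx_form lorG) KB trmx0.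
Qed.

Lemma polar_family_sub u : (U u <= polar G (V u))%VS.
Proof. by rewrite (polarS Gu Gs); exact: tangent_space_sub (VT u). Qed.

(** Every point [x] of [U u] lies in [polar G (T u)], so [generator_tangent_sub_polar] puts [eta]
    inside [polar G (V u)]; at a regular point the dimensions agree. *)
Lemma polar_family_tangent u x eta :
  tangent_hyperplane G (hypersurface U) u x eta ->
  eta = polar G (V u) /\ U u = (x + V u)%VS.
Proof.
move=> [dSx hx eta_dim]; have [x1 _] := dSx; split.
  apply/eqP; rewrite eqEdim eta_dim (dim_polar_point lorG confV) leqnn andbT.
  rewrite (generator_tangent_sub_polar lorG confV polar_family_sub hx (VT u)).
  by have [_] := tangent_space_point hx.
apply: (polar_tangent_addv lorG confV (VT u) x1).
  exact: deSitter_neq (absV u) dSx.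
by have [_] := tangent_space_point hx.
Qed.

Lemma polar_family_regular u :
  exists x, tangent_hyperplane G (hypersurface U) u x (polar G (V u)).
Proof.
have [c [a [cM da au]]] := atlas_cover u.
have [W1 [B [W1a fB]]] := smooth_polar_family cM da.
have [W2 [b [W2a fb]]] := sV cM da.
have [_ oW1 _ sB1 UB1] := fB; have [_ oW2 _ sb2 Vb2] := fb.
pose W := W1 `&` W2; have oW : open W by exact: openI.
have Wa : W a by [].
have sB : smooth_on W B by apply: smooth_onS sB1 => y [].
have sb : smooth_on W b by apply: smooth_onS sb2 => y [].
have [Bf UB] := UB1 a W1a; have [bf Vb] := Vb2 a W2a; rewrite au in UB Vb.
pose D i x := 'D_(delta_mx 0 i) b x.
have sD i : smooth_on W (D i) by exact: smooth_on_derive.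
have bD i y : W y -> b y *m G *m (D i y)^T = 0.
  move=> [_ W2y]; apply: trmx_inj; rewrite (trmx_form lorG) trmx0.
  exact: (conformal_frame_derive lorG confV (delta_mx 0 i) fb W2y).
have BD i y : W y -> B y *m G *m (D i y)^T = 0.
  move=> [W1y W2y]; have [_ UBy] := UB1 y W1y.
  have := subvv (U (par c y)); rewrite {1}UBy /U (conformal_frame fb W2y erefl (VT _)).
  rewrite sub_polar_row_span => /eqP BJ.
  have /submxP[E] := sub_jet_derive b y 1%:M i; rewrite mul1mx => DE.
  by rewrite /D DE trmx_mul mulmxA BJ mul0mx.
(* [sg] is the parameter, on the generator, of the point [V u] itself. *)
have [sg bE] : exists sg : 'rV[R]_2, b a = sg *m B a.
  have : (V u <= U u)%VS by exact: (conformal_sub_polar_tangent lorG confV (VT u)).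
  by rewrite UB Vb row_spanS => /submxP.
pose J := \matrix_(i < m) D i a.
pose S (s : 'rV[R]_2) := \matrix_(i < m) (s *m 'D_(delta_mx 0 i) B a).
pose H s := S s *m G *m J^T.
have bformE (x y : 'rV[R]_m.+3) : bform G x y = (x *m G *m y^T) 0 0 by [].
(* Differentiating the orthogonality of [B] and of [b] to the first derivatives of [b], both sides
   become minus the product of [b a] with second derivatives of [b]. *)
have HS : H sg = J *m G *m J^T.
  apply/matrixP => i j; rewrite !form_entry !rowK !bformE.
  have /(congr1 (mulmx sg)) := derive_orthogonal (delta_mx 0 i) oW sB (sD j) Wa (BD j).
  rewrite mulmxN !mulmxA -bE.
  rewrite (derive_orthogonal (delta_mx 0 i) oW sb (sD j) Wa (bD j)).
  by move=> /oppr_inj ->.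
have bJf : row_free (col_mx (b a) J).
  have -> : col_mx (b a) J = jet b a 1%:M.
    by congr col_mx; apply/row_matrixP => i; rewrite !rowK mul1mx.
  rewrite /row_free -dim_row_span -(conformal_frame fb W2a au (VT u)).
  by rewrite (dim_conformal_tangent_space confV (VT u)).
(* A vector [v] in the kernel of the Gram matrix makes [v *m J] null and orthogonal to [b a], hence
   a multiple of [b a]; independence of [b a] and the rows of [J] then forces [v = 0]. *)
have Hu : H sg \in unitmx.
  rewrite HS -row_free_unit; apply: inj_row_free => v vJ.
  have wb : (v *m J <= b a)%MS.
    apply: contraT => nwb; have := @lorentzian_gt0 _ _ _ lorG (v *m J) (b a).
    suff -> : bform G (v *m J) (v *m J) = 0.
      rewrite ltxx; apply=> //.
      + by rewrite -mxrank_eq0 (eqP bf).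
      + by rewrite bformE (conformal_frame_null confV fb W2a) mxE.
      + rewrite bformE -2!mulmxA (_ : J *m _ = 0) ?mulmx0 ?mxE//.
        apply/matrixP => i j; rewrite mulmxA form_entry rowK row_id bformE.
        by rewrite (conformal_frame_derive lorG confV _ fb W2a) !mxE.
    by rewrite bformE trmx_mul !mulmxA -(mulmxA v) -(mulmxA v) vJ mul0mx mxE.
  have /sub_rVP[c' vE] := wb.
  have : row_mx (- c'%:M) v *m col_mx (b a) J = 0.
    by rewrite mul_row_col vE mulNmx mul_scalar_mx addNr.
  move=> /eqP; rewrite mulmx_free_eq0// => /eqP; rewrite -row_mx0 => /eq_row_mx[_ ->].
  by [].
have [rho rho_sg] : exists rho : 'rV[R]_2, ~~ (rho <= sg)%MS.
  apply: contrapT => /forallNP le_sg.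
  have : (1%:M <= sg)%MS by apply/row_subP => i; apply: contrapT => /negP; exact: le_sg.
  by move=> /mxrankS; rewrite mxrank1 => /leq_trans/(_ (rank_leq_row _)).
(* [H] is linear in the parameter, so a suitable shift of [rho] along [sg] makes [H s] invertible.
   The shift keeps [s] off the line of [sg], so the point found is not [V u]. *)
have [t Htu] := exists_unitmx_shift (H rho) Hu.
pose s := rho + t *: sg.
have Hsu : H s \in unitmx.
  have -> : H s = H rho + t *: H sg => //.
  rewrite /H !scalemxAl -!mulmxDl; congr (_ *m _ *m _).
  by apply/row_matrixP => i; rewrite linearD linearZ/= !rowK mulmxDl scalemxAl.
have s_sg : ~~ (s <= sg)%MS.
  apply: contra rho_sg => s_sg; rewrite -[rho](addrK (t *: sg)).
  by apply: addmx_sub => //; rewrite eqmx_opp; exact: scalemx_sub.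
have s0 : s != 0 by apply: contraNneq s_sg => ->; exact: sub0mx.
pose x := <[s *m B a]>%VS; pose eta := row_span (jet B a s).
have hx : tangent_space 2 U u x eta.
  by apply/tangent_spaceP; exists c, W1, B, a, s.
have BJ : B a *m G *m J^T = 0.
  apply/matrixP => i j; rewrite form_entry rowK bformE -!row_mul BD//.
  by rewrite !mxE.
(* A relation among the rows of the jet is paired with the rows of [J]: the frame part vanishes by
   [BJ], and invertibility of [H s] kills the coefficients of the derivatives. The rest follows from
   the freeness of [B a]. *)
have eta_dim : \dim eta = m.+2.
  rewrite dim_row_span; apply/eqP/inj_row_free => v.
  rewrite -[v]hsubmxK mul_row_col => v0.
  have /eqP : rsubmx v *m H s = 0.
    move/(congr1 (mulmx^~ (G *m J^T))): v0.
    by rewrite mul0mx mulmxDl -!mulmxA (mulmxA (B a)) BJ mulmx0 add0r /H !mulmxA.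
  rewrite mulmx_free_eq0 ?row_free_unit// => /eqP v20.
  move: v0; rewrite v20 mul0mx addr0 => /eqP.
  by rewrite mulmx_free_eq0// => /eqP ->; rewrite row_mx0.
have hyp : tangent_hyperplane G (hypersurface U) u x eta.
  split=> //; have [x1 xU] := tangent_space_point hx.
  apply: (deSitter_polar lorG (absV u) x1).
    exact: subv_trans xU (polar_family_sub u).
  move=> xV; move: s_sg; rewrite -(submxMfree _ _ Bf) -bE -row_spanS row_span_row.
  by rewrite -/x xV Vb subvv.
by exists x; have [<-] := polar_family_tangent hyp.
Qed.

End polar_family.

(** * The correspondence *)

(** The coefficients of the equations of the polar of [A] are the rows of [A *m G], so dual
    coordinates of a tangent hyperplane are its pole multiplied by [G]. *)
Lemma polar_dual (R : realType) N (G : 'M[R]_N) k (A : 'M[R]_(k, N)) :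
  G^T = G -> polar 1%:M (polar G (row_span A)) = row_span (A *m G).
Proof.
move=> Gs; have -> : polar G (row_span A) = polar 1%:M (row_span (A *m G)).
  by rewrite !polar_row_span trmx_mul Gs mul1mx.
by rewrite polarK ?unitmx1 ?trmx1.
Qed.

Section lightlike.
Context {R : realType} {m : nat} (G : 'M[R]_m.+3) (M : manifold R m).
Hypothesis lorG : lorentzian G.
Implicit Types (U V : M -> psubspace R m.+3).

Let Gs : G^T = G := lorentzian_sym lorG.
Let Gu : G \in unitmx := lorentzian_unit lorG.

(** The tangent hyperplane along [U u] is [polar G (V u)], whose dual coordinates are those of [V u]
    multiplied by [G]; the rank of [U] is therefore that of [V]. *)
Lemma polar_family_maximal V T : conformal_hypersurface G (hypersurface V) ->
  (forall u, tangent_space 1 V u (V u) (T u)) ->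
  lightlike_maximal G (hypersurface (fun u => polar G (T u))) /\
  tangency_points G (hypersurface (fun u => polar G (T u))) V.
Proof.
move=> confV VT; have [sV absV rV] := confV.
split; last first.
  move=> u x eta /(polar_family_tangent lorG confV VT)[-> _].
  by split=> //; exact: absV.
split.
  split; first exact: (smooth_polar_family lorG confV VT).
    move=> u; have [x hx] := polar_family_regular lorG confV VT u.
    by exists x, (polar G (V u)).
  move=> u x eta /(polar_family_tangent lorG confV VT)[-> UE].
  by exists (V u); split=> //; split=> //; exact: absV.
exists (fun u => polar G (V u)); split=> u.
  move=> eta; split=> [[x /(polar_family_tangent lorG confV VT)[]//]|->].
  exact: polar_family_regular.
apply: (rank_at_mulmx Gu _ (rV u)) => v B /= ->.
exact: polar_dual.
Qed.

(** The pole of the tangent hyperplane is its dual point multiplied by [invmx G]. The condition on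
    the rank thus provides both smooth frames of [V] and the immersion property. *)
Lemma lightlike_tangency U : lightlike_maximal G (hypersurface U) ->
  exists V, tangency_points G (hypersurface U) V /\
    conformal_hypersurface G (hypersurface V).
Proof.
move=> [[sU regU nullU] [eta [etaP rk]]].
have /choice[V etaV] u : exists z, tangent_to_absolute G (eta u) z.
  have [x hx] := (etaP u (eta u)).2 erefl.
  by have [z [hz _]] := nullU _ _ _ hx; exists z.
have VE u (B : 'rV[R]_m.+3) :
    polar 1%:M (eta u) = row_span B -> V u = row_span (B *m invmx G).
  have [[V1 _] ->] := etaV u; have [A _ VA] := row_spanP V1.
  have Gf : row_free G by rewrite row_free_unit.
  rewrite VA polar_dual// => /eqP; rewrite eqEsubv !row_spanS => AB.
  apply/eqP; rewrite eqEsubv !row_spanS.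
  by rewrite -(submxMfree A _ Gf) -(submxMfree _ A Gf) mulmxKV.
have Giu : invmx G \in unitmx by rewrite unitmx_inv.
exists V; split.
  move=> u x eta' hx; have -> : eta' = eta u by apply/etaP; exists x.
  exact: etaV.
split; last by move=> u; exact: (rank_at_mulmx Giu VE (rk u)).
  apply: smooth_familyP => u; have [T [/tangent_spaceP hT _]] := rk u.
  have [c [W [B [a [s [fB [Wa au] _ _]]]]]] := hT.
  exists c, W, (fun x => B x *m invmx G), a; split=> //.
  exact: local_frame_mulmx fB.
by move=> u; have [] := etaV u.
Qed.

(** At a regular point [x] the tangent hyperplane is polar to [V u], which forces [x] into
    [polar G T]. Both sides are then the line joining [x] to [V u]. *)
Lemma lightlike_polar U V u T :
  lightlike_hypersurface G (hypersurface U) ->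
  tangency_points G (hypersurface U) V ->
  conformal_hypersurface G (hypersurface V) ->
  tangent_space 1 V u (V u) T -> U u = polar G T.
Proof.
move=> [sU regU nullU] UV confV hT; have [sV absV _] := confV.
have UVp v : (U v <= polar G (V v))%VS.
  have [x [eta hx]] := regU v; have [_ <-] := UV _ _ _ hx.
  by have [_ htx _] := hx; exact: tangent_space_sub htx.
have [x [eta hx]] := regU u; have [_ etaV] := UV _ _ _ hx.
have [dSx htx _] := hx; have [x1 _] := dSx.
have xT : (x <= polar G T)%VS.
  by rewrite -(generator_tangent_sub_polar lorG confV UVp htx hT) etaV.
rewrite (polar_tangent_addv lorG confV hT x1 (deSitter_neq (absV u) dSx) xT).
have [z [[_ etaz] /= ->]] := nullU _ _ _ hx.
by congr (_ + _)%VS; apply: (polar_inj Gu Gs); rewrite -etaz.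
Qed.

End lightlike.

Section transport.
Context {R : realType} {m : nat} (G : 'M[R]_m.+3).
Hypothesis lorG : lorentzian G.
Implicit Types U : subspace_family R m.+1.

Let Gs : G^T = G := lorentzian_sym lorG.
Let Gu : G \in unitmx := lorentzian_unit lorG.

(** A reparametrization carries a regular point to a regular point with the same tangent hyperplane,
    and the hyperplane determines its pole. *)
Lemma same_tangency U U' (V : base U -> psubspace R m.+3)
    (V' : base U' -> psubspace R m.+3) :
  lightlike_hypersurface G U -> lightlike_hypersurface G U' ->
  tangency_points G U V -> tangency_points G U' V' ->
  same_family U U' -> same_family (SubspaceFamily V) (SubspaceFamily V').
Proof.
move=> [_ regU _] [sU' _ _] UV UV' [h [dh UU']]; exists h; split=> // u /=.
have [x [eta hx]] := regU u; have [dSx htx eta_dim] := hx.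
have hx' : tangent_hyperplane G U' (h u) x eta.
  by split=> //; exact: (tangent_space_transport dh UU' sU' htx).
apply: (polar_inj Gu Gs).
by have [_ <-] := UV _ _ _ hx; have [_ <-] := UV' _ _ _ hx'.
Qed.

(** Generators are polars of the tangent spaces of [V], and these are invariant under
    reparametrization. *)
Lemma same_lightlike U U' (V : base U -> psubspace R m.+3)
    (V' : base U' -> psubspace R m.+3) :
  lightlike_hypersurface G U -> lightlike_hypersurface G U' ->
  tangency_points G U V -> tangency_points G U' V' ->
  conformal_hypersurface G (SubspaceFamily V) ->
  conformal_hypersurface G (SubspaceFamily V') ->
  same_family (SubspaceFamily V) (SubspaceFamily V') -> same_family U U'.
Proof.
case: U U' V V' => [M U] [M' U'] /= V V' lU lU' UV UV' confV confV' [h [dh VV']].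
exists h; split=> // u /=.
have [T hT] := conformal_tangent_space confV u.
rewrite (lightlike_polar lorG lU UV confV hT).
apply: (lightlike_polar lorG lU' UV' confV').
have [sV' _ _] := confV'.
by have := tangent_space_transport dh VV' sV' hT; rewrite -[V u]VV'.
Qed.

End transport.

(** Quantifying over all representatives [U] of [C] and all their tangency maps avoids choosing one;
    [tangency_classE] computes the result from any of them. *)
Definition tangency_class (R : realType) n (G : 'M[R]_n.+2)
    (C : subspace_family R n -> Prop) : subspace_family R n -> Prop :=
  fun F => exists U (V : base U -> psubspace R n.+2),
    [/\ lightlike_maximal G U, C = family_class U, tangency_points G U V &
        same_family (SubspaceFamily V) F].

Lemma tangency_classE (R : realType) m (G : 'M[R]_m.+3)
    (U : subspace_family R m.+1) (V : base U -> psubspace R m.+3) :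
  lorentzian G -> lightlike_maximal G U -> tangency_points G U V ->
  tangency_class G (family_class U) = family_class (SubspaceFamily V).
Proof.
move=> lorG maxU UV; apply/funext => F; apply/propext; split=> [|VF]; last first.
  by exists U, V.
move=> [U' [V' [maxU' /family_classP UU' UV' VF']]].
apply: same_family_trans VF'.
by apply: (same_tangency lorG) UU' => //; [case: maxU|case: maxU'].
Qed.

Theorem theorem3 (R : realType) (n : nat) (G : 'M[R]_n.+2) :
  (0 < n)%N -> lorentzian G ->
  exists Phi : (subspace_family R n -> Prop) -> (subspace_family R n -> Prop),
    one_to_one (lightlike_hypersurfaces_maximal G) (conformal_hypersurfaces G)
      Phi /\
    forall U : subspace_family R n, lightlike_maximal G U ->
      exists y : base U -> psubspace R n.+2,
        [/\ tangency_points G U y,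
            conformal_hypersurface G (SubspaceFamily y),
            Phi (family_class U) = family_class (SubspaceFamily y) &
            forall u : base U,
              tangent_pencil G (SubspaceFamily y) u = points_of (U u)].
Proof.
case: n G => [//|m] G _ lorG.
have tangency (U : subspace_family R m.+1) : lightlike_maximal G U ->
    exists y : base U -> psubspace R m.+3,
      tangency_points G U y /\ conformal_hypersurface G (SubspaceFamily y).
  by case: U => M U; exact: lightlike_tangency.
exists (tangency_class G); split; last first.
  move=> U maxU; have [y [Uy confy]] := tangency U maxU.
  exists y; split=> // [|u]; first exact: tangency_classE.
  case: U maxU y Uy confy u => M U maxU y Uy confy u.
  have [T hT] := conformal_tangent_space confy u.
  rewrite (tangent_pencil_polar lorG confy hT).
  by rewrite -(lightlike_polar lorG maxU.1 Uy confy hT).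
split.
- move=> _ [U maxU ->]; have [y [Uy confy]] := tangency U maxU.
  by exists (SubspaceFamily y) => //; exact: tangency_classE.
- move=> _ _ [U maxU ->] [U' maxU' ->].
  have [y [Uy confy]] := tangency U maxU.
  have [y' [Uy' confy']] := tangency U' maxU'.
  rewrite (tangency_classE lorG maxU Uy) (tangency_classE lorG maxU' Uy').
  move=> /family_classP yy'; apply/family_classP.
  exact: (same_lightlike lorG maxU.1 maxU'.1 Uy Uy' confy confy' yy').
- move=> _ [[M V] confV ->].
  (* A preimage of [V] is the family of lines polar to its tangent spaces [T u]. *)
  have /choice[T VT] := conformal_tangent_space confV.
  have [maxU UV] := polar_family_maximal lorG confV VT.
  exists (family_class (hypersurface (fun u => polar G (T u)))).
    by exists (hypersurface (fun u => polar G (T u))).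
  exact: (tangency_classE lorG maxU UV).
Qed.
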